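(* For every $\varepsilon>0$ there exists a constant $C_\varepsilon>0$ depending only on $\varepsilon$ such that for every dimension $d\ge4$, every $p\in[2,\infty]$ and every $f\in\ell^p(\mathbb{Z}^d)$, $$\Big\|\sup_{n\in\mathbb{N}_0:\, n\le d^{1-\varepsilon}}|\mathcal{S}_{\sqrt n}f|\Big\|_{\ell^p(\mathbb{Z}^d)}\le C_\varepsilon\|f\|_{\ell^p(\mathbb{Z}^d)} .$$
   Context: $\mathbb{N}_0=\{0,1,2,\dots\}$. For $d\ge4$ and $n\in\mathbb{N}_0$ let $\sqrt nS=\{y\in\mathbb{Z}^d:\sum_{j=1}^d y_j^2=n\}$ (which is non-empty because $d\ge4$), with $|\sqrt nS|$ elements. The spherical averaging operator is $\mathcal{S}_{\sqrt n}f(x)=\frac{1}{|\sqrt nS|}\sum_{y\in\sqrt nS}f(x-y)$ for $x\in\mathbb{Z}^d$. *)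

(* Defs.v *)
From HB Require Import structures.
From mathcomp Require Import all_boot all_order all_algebra finmap.
From mathcomp Require Import all_classical all_reals all_analysis.
From mathcomp Require Export complex.
Set Implicit Arguments.
Unset Strict Implicit.
Unset Printing Implicit Defensive.
Import Order.TTheory GRing.Theory Num.Theory.
Import numFieldNormedType.Exports.
Local Open Scope classical_set_scope.
Local Open Scope ring_scope.

Definition lattice (d : nat) : Type := 'rV[int]_d.
HB.instance Definition _ (d : nat) := GRing.Zmodule.on (lattice d).
HB.instance Definition _ (d : nat) := isPointed.Build (lattice d) 0.
(* Every subset of Z^d is measurable. *)
HB.instance Definition _ (d : nat) :=
  @isMeasurable.Build default_measure_display (lattice d)
    discrete_measurable discrete_measurable0
    discrete_measurableC discrete_measurableU.

Definition sphere (d n : nat) : set (lattice d) :=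
  [set y | \sum_(j < d) (y : 'rV[int]_d) ord0 j ^+ 2 = n%:Z].

Lemma finite_sphere (d n : nat) : finite_set (@sphere d n).
Proof.
pose g (y : {ffun 'I_d -> 'I_(n + n).+1}) : lattice d :=
  \row_j ((y j : nat)%:Z - n%:Z).
apply: (@sub_finite_set _ _ (g @` [set: {ffun 'I_d -> 'I_(n + n).+1}])); last first.
  exact/finite_image/finite_finset.
move=> y /= sy.
have Hj j : `|(y : 'rV[int]_d) ord0 j| <= n%:Z.
  have le_sq : (y : 'rV[int]_d) ord0 j ^+ 2 <= n%:Z.
    rewrite -sy (bigD1 j) //= lerDl; apply: sumr_ge0 => i _; exact: sqr_ge0.
  apply: le_trans le_sq; rewrite -real_normK ?num_real//.
  case: (`|_ ord0 j|) (normr_ge0 ((y : 'rV[int]_d) ord0 j)) => // -[|k] _ //.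
  by rewrite ler_eXnr.
exists [ffun j => inord (absz ((y : 'rV[int]_d) ord0 j + n%:Z))] => //.
apply/rowP => j; rewrite /g mxE ffunE.
have := Hj j; rewrite ler_norml => /andP[lo hi].
have pos : 0 <= (y : 'rV[int]_d) ord0 j + n%:Z by rewrite -lerBlDr sub0r.
rewrite inordK ?gez0_abs ?addrK//.
by rewrite ltnS -lez_nat gez0_abs// PoszD lerD2r.
Qed.

Definition sphere_avg (R : realType) (d n : nat) (f : lattice d -> R[i])
    (x : lattice d) : R[i] :=
  (#|` fset_set (@sphere d n)|%:R)^-1 * \sum_(y \in @sphere d n) f (x - y).

(* [ComplexField.Normc.normc] is the real-valued modulus on [R[i]], whereas the
   generic norm [`|z|] takes values in [R[i]]. *)
Definition cabs (R : realType) (z : R[i]) : \bar R :=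
  (ComplexField.Normc.normc z)%:E.

Definition lp_norm (R : realType) (d : nat) (p : \bar R)
    (g : lattice d -> \bar R) : \bar R :=
  ('N[counting]_p [g])%E.

Definition sphere_maximal (R : realType) (d : nat) (N : R)
    (f : lattice d -> R[i]) (x : lattice d) : \bar R :=
  ereal_sup [set cabs (sphere_avg n f x) | n in [set n : nat | n%:R <= N]].

(* Main.v *)
Require Import Defs.
From mathcomp Require Import all_boot all_order all_algebra all_fingroup finmap.
From mathcomp Require Import ring lra zify.
From mathcomp Require Import all_classical all_reals all_analysis.
Import measurable_realfun ess_sup_inf.
Import Order.TTheory GRing.Theory Num.Theory.
Import numFieldNormedType.Exports.
From mathcomp Require Import fintype finset.
Set Implicit Arguments.
Unset Strict Implicit.
Unset Printing Implicit Defensive.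
Local Open Scope ring_scope.

(** Why the maximal theorem holds.

    Reduction to squares.  A spherical mean is an average, so Jensen's
    inequality gives (S g)^(p/2) <= S (g^(p/2)) for p >= 2 and g >= 0
    (sphere_mean_powR).  Hence it suffices to find, for every h >= 0, a single
    function H that dominates all the squares (S_n h)^2 with n in the given
    range and whose sum is at most C times the sum of h^2; all finite p >= 2
    follow with the same constant, and p = oo is immediate (lp_from_l2).
    In dimensions bounded in terms of eps, H is the sum over n of the means of
    h^2 (l2_small).  So d is large and n <= N = d^(1-eps).

    Removing large entries.  Replacing an entry 0 by 1 or -1 shows that, for
    n <= d/2, the number of points of square norm n is at least d/n times the
    number of points of square norm n-1 (size_sphere_seq_step).  Deleting an
    entry beyond K in absolute value lowers the square norm by at least
    (K+1)^2, so the points with such an entry form a fraction of at most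
    2 d (n+1) (n/d)^((K+1)^2) of the sphere (count_wide), which is summable over
    n <= N once K is large in terms of eps.

    Reduction to the cube.  Cut the coordinates into K blocks and let the stamp
    of a set H of coordinates be the point supported on H whose entry at j is
    the number of the block of j, counted from 1.  On the spheres considered,
    every point with entries at most K is a signed permutation of the stamp of
    any H that meets each block in the right number of coordinates
    (stamp_orbit).  So, after averaging over all signed permutations, the mean
    over a sphere is an average of compositions of operators on the cube
    {set 'I_d}, one for each block, each averaging over the subsets of
    prescribed size of the block (narrow_point_le).  Flipping signs along I
    turns a translation of the cube by I into a translation of the lattice
    (signed_perm_stamp).  Therefore an l^2 bound on the cube yields the same
    bound on the lattice (max_at_l2): no Fourier analysis on the lattice is
    involved, and nothing depends on the dimension.

    The cube.  What remains is a bound, with a universal constant, for the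
    maximal function of the averages over the n-subsets of one set A, for
    n <= |A|/32 (cube_maximal).  As in the Littlewood-Paley argument of Stein
    and of Harrow, Kolla and Schulman, the n-th average is compared with the
    mean of the averages of smaller size and equal parity (tauberian).  The
    mean is dominated by conditional averages along a random chain of subsets
    of A (perm_average_cond_avg, sum_bin_half), for which Doob's inequality
    holds (doob_selector).  The difference is a square function, which Walsh
    analysis turns into the estimate
    sum_n (n+1) (kappa_(n+2) - kappa_n)^2 <= 100 for normalised Krawtchouk
    polynomials kappa (square_function).  This follows from their three-term
    recurrence by summation by parts (energy_bound). *)

(** * An energy estimate for a three-term recurrence *)

Section energy.
Variables (R : realFieldType) (s x : R) (u : nat -> R) (q : nat).
Hypotheses (s0 : 0 <= s) (x0 : 0 <= x) (x1 : 2 * x <= 1).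
Hypothesis qs : 32 * (q%:R * s) <= 1.
Hypothesis u1 : forall n, (u n) ^+ 2 <= 1.
Hypothesis rec : forall n, (n < q)%N ->
  (1 - n%:R * s) * (u n.+1 - u n) = n%:R * s * (u n - u n.-1) - 2 * x * u n.

Let a n := (u n) ^+ 2.
Let b n := (u n - u n.-1) ^+ 2.
Let A N := \sum_(n < N) a n.
Let B N := \sum_(n < N) b n.+1.
Let W N := \sum_(n < N) n%:R * a n.
Let D N := \sum_(n < N) n.+1%:R * b n.+1.

Let a0 n : 0 <= a n. Proof. exact: sqr_ge0. Qed.
Let b0 n : 0 <= b n. Proof. exact: sqr_ge0. Qed.
Let A0 N : 0 <= A N. Proof. by apply: sumr_ge0. Qed.
Let b00 : b 0 = 0. Proof. by rewrite /b /= subrr expr0n. Qed.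
Let ns0 n : 0 <= n%:R * s. Proof. by rewrite mulr_ge0. Qed.
Let W0 N : 0 <= W N. Proof. by apply: sumr_ge0 => i _; rewrite mulr_ge0. Qed.

Let small n : (n <= q)%N -> 32 * (n%:R * s) <= 1.
Proof.
move=> nq; apply: le_trans qs; rewrite ler_pM2l// ler_wpM2r// ler_nat//.
Qed.

(** The recurrence reads (1 - t) v' = t v - 2 x u_n with t <= 1/32, where v and
    v' are consecutive increments; Young's inequality splits the cross term. *)
Let step_b n : (n < q)%N -> b n.+1 <= b n / 15 + 5 * x ^+ 2 * a n.
Proof.
move=> nq; have := rec nq; have := small (ltnW nq); have := ns0 n.
rewrite /b /a /=; set t := n%:R * s; set v' := u n.+1 - u n.
set v := u n - u n.-1; set w := u n => t0 t1 e.
have e2 : ((1 - t) * v') ^+ 2 = (t * v - 2 * x * w) ^+ 2 by rewrite e.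
have h1 : ((1 - t) * v') ^+ 2 <= 9 * t ^+ 2 * v ^+ 2 + (9 / 2) * (x * w) ^+ 2.
  have : 0 <= (4 * (t * v) + (x * w)) ^+ 2 by apply: sqr_ge0.
  by rewrite e2; nra.
have h2 : t ^+ 2 <= 1 / 1024 by nra.
have h3 : 961 / 1024 <= (1 - t) ^+ 2 by nra.
have := sqr_ge0 v; have := sqr_ge0 v'; have := sqr_ge0 (x * w).
rewrite [((1 - t) * _) ^+ 2]exprMn [(x * w) ^+ 2]exprMn in h1 *; rewrite -[_ * _ * w ^+ 2]mulrA.
move: (v ^+ 2) (v' ^+ 2) (x ^+ 2 * w ^+ 2) h1 => V V' X h1 X0 V'0 V0.
have k1 : 961 / 1024 * V' <= (1 - t) ^+ 2 * V' by rewrite ler_wpM2r.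
have k2 : t ^+ 2 * V <= 1 / 1024 * V by rewrite ler_wpM2r.
lra.
Qed.

(** The recurrence multiplied by 2 u_n, with the products of u_n and an
    increment polarised: this form can be summed by parts. *)
Let step_a n : (n < q)%N ->
  4 * x * a n = n%:R * s * (a n - a n.-1) + n%:R * s * b n
    + (1 - n%:R * s) * (a n - a n.+1) + (1 - n%:R * s) * b n.+1.
Proof.
move=> /rec; rewrite /a /b /=.
set t := n%:R * s => e.
have -> : 4 * x * u n ^+ 2 = 2 * u n * (2 * x * u n) by ring.
have -> : 2 * x * u n = t * (u n - u n.-1) - (1 - t) * (u n.+1 - u n).
  by rewrite e; ring.
ring.
Qed.

Let sumB N : (N <= q)%N -> 14 / 15 * B N + 1 / 15 * b N <= 5 * x ^+ 2 * A N.
Proof.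
elim: N => [_|N IH Nq].
  by rewrite /B /A !big_ord0 b00; lra.
have := IH (ltnW Nq); have := step_b Nq; rewrite /B /A !big_ord_recr /= -/(B N) -/(A N).
lra.
Qed.

(** A potential whose decrement absorbs, up to terms of favourable sign, the
    differences of [a] in step_a: summation by parts becomes an induction. *)
Let psi (n : nat) := (1 - n%:R * s + s) * a n - (n%:R * s - s) * a n.-1.

Let sumA1 N : (N <= q)%N ->
  4 * x * A N + psi N + N%:R * s * b N <= 1 + 2 * s + (1 + s) * B N.
Proof.
elim: N => [_|N IH Nq].
  rewrite /B /A /psi !big_ord0 b00 /= !mul0r.
  have := u1 0%N; rewrite -/(a 0%N) => h.
  have : s * a 0%N <= s * 1 by rewrite ler_wpM2l.
  lra.
have := IH (ltnW Nq); have := step_a Nq.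
have -> : B N.+1 = B N + b N.+1 by rewrite /B big_ord_recr.
have -> : A N.+1 = A N + a N by rewrite /A big_ord_recr.
have es : N.+1%:R * s = N%:R * s + s by rewrite -natr1 mulrDl mul1r.
rewrite /psi /= es.
have := mulr_ge0 s0 (a0 N); have := mulr_ge0 s0 (a0 N.-1).
have := ns0 N.
move: (N%:R * s) (A N) (B N) (a N) (a N.-1) (a N.+1) (b N) (b N.+1).
move=> t P Q c c' c'' e e' t0.
lra.
Qed.

Let s1 : (0 < q)%N -> 32 * s <= 1.
Proof. by move=> q0; have := small q0; rewrite mul1r. Qed.

(** The differences telescope to at most a constant, and by sumB the increments
    contribute at most 5.4 x^2 A <= 2.7 x A, which is less than 4 x A. *)
Let xA N : (N <= q)%N -> (0 < q)%N -> x * A N <= 1.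
Proof.
move=> Nq /s1 s1'; have := sumA1 Nq; have := sumB Nq; have := small Nq.
have := ns0 N; have := u1 N.-1; rewrite -/(a N.-1) /psi.
have := a0 N.-1; have := a0 N; have := b0 N; have := A0 N.
have B0 : 0 <= B N by apply: sumr_ge0.
set t : R := N%:R * s => A' b' a' c' c1 t0 t1 hB hA.
have h : x ^+ 2 * A N <= x * A N / 2.
  have : x * A N * (2 * x) <= x * A N * 1 by rewrite ler_wpM2l// mulr_ge0.
  by lra.
have h2 : (1 + s) * B N <= (33 / 32) * B N by rewrite ler_wpM2r//; lra.
have h3 : 0 <= t * b N by rewrite mulr_ge0.
have h4 : 0 <= (1 - t + s) * a N.
  have h4 : 0 <= 1 - t + s by move: s0; lra.
  by rewrite mulr_ge0.
have h5 : t * a N.-1 <= 1 / 32.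
  have : t * a N.-1 <= t * 1 by rewrite ler_wpM2l.
  by lra.
have h6 : 0 <= s * a N.-1 by rewrite mulr_ge0.
lra.
Qed.

Let sumD N : (N <= q)%N ->
  14 / 15 * D N + 1 / 15 * (N%:R * b N) + 1 / 15 * b N
    <= 5 * x ^+ 2 * (W N + A N) + 1 / 15 * B N.
Proof.
elim: N => [_|N IH Nq].
  by rewrite /D /W /B /A !big_ord0 b00; lra.
have := IH (ltnW Nq); have := step_b Nq.
have -> : B N.+1 = B N + b N.+1 by rewrite /B big_ord_recr.
have -> : A N.+1 = A N + a N by rewrite /A big_ord_recr.
have -> : W N.+1 = W N + N%:R * a N by rewrite /W big_ord_recr.
have -> : D N.+1 = D N + N.+1%:R * b N.+1 by rewrite /D big_ord_recr.
move=> h; have : N.+1%:R * b N.+1 <= N.+1%:R * (b N / 15 + 5 * x ^+ 2 * a N).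
  by rewrite ler_pM2l// ltr0Sn.
rewrite -natr1; move: (N%:R : R) => t h1 h2.
have -> : 5 * x ^+ 2 * (W N + t * a N + (A N + a N)) =
  5 * x ^+ 2 * (W N + A N) + (t + 1) * (5 * x ^+ 2 * a N) by ring.
lra.
Qed.

(** The analogue of [psi] for step_a multiplied by n. *)
Let theta (n : nat) := (n%:R - 1) * (1 - n%:R * s + s) * a n
  - (n%:R - 1) ^+ 2 * s * a n.-1.

Let sumW N : (N <= q)%N ->
  4 * x * W N + theta N + N%:R ^+ 2 * s * b N <= 2 * A N + (1 + s) * D N.
Proof.
elim: N => [_|N IH Nq].
  rewrite /D /W /A /theta !big_ord0 b00 /=.
  have := a0 0%N; have := mulr_ge0 s0 (a0 0%N); lra.
have := IH (ltnW Nq).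
have s1' : 32 * s <= 1 by apply: s1; apply: leq_ltn_trans Nq.
have := congr1 (fun z => N%:R * z) (step_a Nq).
have -> : A N.+1 = A N + a N by rewrite /A big_ord_recr.
have -> : W N.+1 = W N + N%:R * a N by rewrite /W big_ord_recr.
have -> : D N.+1 = D N + N.+1%:R * b N.+1 by rewrite /D big_ord_recr.
have h0 : 0 <= (1 - N%:R * s) * b N.+1.
  by rewrite mulr_ge0//; have := small (ltnW Nq); lra.
have hb : (1 - N%:R * s) * b N.+1 =  b N.+1 - N%:R * s * b N.+1 by ring.
have ha : N%:R * (N%:R * s) * (a N - a N.-1) + N%:R * (1 - N%:R * s) * (a N - a N.+1)
    <= theta N - theta N.+1 + 2 * a N.
  rewrite /theta; case: N {IH Nq h0 hb} => [|N].
    rewrite /=; have := a0 0%N => h.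
    have h' : (2 * s) * a 0%N <= a 0%N by rewrite ler_piMl//; move: s0; lra.
    have h'' : 0 <= s * a 0%N by rewrite mulr_ge0.
    lra.
  rewrite /= -!natr1.
  have := mulr_ge0 (ns0 N) (a0 N).
  have := mulr_ge0 s0 (a0 N).
  have := mulr_ge0 (ns0 N) (a0 N.+1).
  have := mulr_ge0 s0 (a0 N.+1).
  have := a0 N.+1; move: (a N) (a N.+1) (a N.+2) (N%:R : R) => c c' c'' t.
  lra.
move: h0 ha IH; rewrite -[N.+1%:R]natr1 /=.
have -> : 4 * x * (W N + N%:R * a N) = 4 * x * W N + N%:R * (4 * x * a N) by ring.
move: (theta N) (theta N.+1) => th th' h0 ha IH e.
rewrite e; move: (W N) (D N) (A N) (N%:R : R) (a N) (a N.-1) (a N.+1) (b N)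
  (b N.+1) h0 ha IH {e hb} => w d y t c c' c'' f f' h0 ha IH.
lra.
Qed.

(** In the application s = 1/|A|, x = k/|A| and u_n is the value at k of the n-th
    normalised Krawtchouk polynomial.  Summing u_n times the recurrence by parts gives
    x A <= 1; summing n u_n times the recurrence gives x^2 W <= 4.  The weighted
    sum D of squared increments is at most about 5 x^2 (W + A), because each
    increment is small compared with the preceding one and x u_n.  The condition
    32 q s <= 1 leaves room to absorb all error terms; 25 comes from these crude
    constants. *)
Lemma energy_bound : \sum_(n < q) n.+1%:R * (u n.+1 - u n) ^+ 2 <= 25.
Proof.
change (D q <= 25).
have [->|q0] := posnP q; first by rewrite /D big_ord0.
have s1' := s1 q0; have h1 := sumB (leqnn q); have h2 := xA (leqnn q) q0.
have h3 := sumD (leqnn q); have h4 := sumW (leqnn q).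
have xxA : x ^+ 2 * A q <= 1 / 2.
  have -> : x ^+ 2 * A q = x * (x * A q) by ring.
  have : x * (x * A q) <= x * 1 by rewrite ler_wpM2l.
  by move: x1; lra.
have xxW : x ^+ 2 * W q <= x * W q / 2.
  have -> : x ^+ 2 * W q = x * (x * W q) by ring.
  have : (x * W q) * (2 * x) <= (x * W q) * 1 by rewrite ler_wpM2l// mulr_ge0.
  by lra.
have B0 : 0 <= B q by apply: sumr_ge0.
have D0 : 0 <= D q by apply: sumr_ge0 => i _; rewrite mulr_ge0.
have qb : q%:R * b q <= D q.
  case: (q) q0 => // n _; rewrite /D big_ord_recr /= lerDr.
  by apply: sumr_ge0 => i _; rewrite mulr_ge0.
have th : - theta q <= 2 * (q%:R * (q%:R * s) * b q).
  rewrite /theta; case: (q) q0 qs {h1 h2 h3 h4 xxA xxW B0 D0 qb} => // n _.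
  have -> : (n.+1%:R : R) = n%:R + 1 by rewrite natr1.
  rewrite /= addrK => t1.
  have k : a n <= 2 * a n.+1 + 2 * b n.+1.
    rewrite /a /b /=; have := sqr_ge0 (2 * u n.+1 - u n); nra.
  have n0 : 0 <= (n%:R : R) by [].
  have k2 : n%:R * (n%:R * s) * a n <= n%:R * (n%:R * s) * (2 * a n.+1 + 2 * b n.+1).
    by rewrite ler_wpM2l// mulr_ge0.
  have k3 : (n%:R * s) * (n%:R * a n.+1) <= 1 / 32 * (n%:R * a n.+1).
    apply: ler_wpM2r; first exact: mulr_ge0.
    by move: s0 t1; lra.
  have k4 : 0 <= n%:R * a n.+1 by rewrite mulr_ge0.
  have k5 : 0 <= (n%:R * s) * b n.+1 by rewrite mulr_ge0.
  have k6 : 0 <= s * b n.+1 by rewrite mulr_ge0.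
  have k7 : 0 <= (n%:R * s) * (n%:R * a n.+1) by rewrite mulr_ge0.
  have k8 : 0 <= s * (n%:R * a n.+1) by rewrite mulr_ge0.
  move: (a n) (a n.+1) (b n.+1) (n%:R : R) k k2 k3 k4 k5 k6 k7 k8.
  move=> c c' f t *; lra.
have e1 : q%:R * (q%:R * s) * b q <= 1 / 32 * D q.
  have -> : q%:R * (q%:R * s) * b q = (q%:R * s) * (q%:R * b q) by ring.
  apply: (@le_trans _ _ (1 / 32 * (q%:R * b q))); last by lra.
  by apply: ler_wpM2r; [exact: mulr_ge0|move: qs; lra].
have e2 : s * D q <= 1 / 32 * D q by rewrite ler_wpM2r//; lra.
have qb0 : 0 <= q%:R * b q by rewrite mulr_ge0.
have bq := b0 q.
have xW0 : 0 <= x * W q by rewrite mulr_ge0.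
have f0 : 14 / 15 * B q <= 5 * (x ^+ 2 * A q) by lra.
have f1 : 14 / 15 * D q <= 5 * (x ^+ 2 * W q) + 5 * (x ^+ 2 * A q) + 1 / 15 * B q by lra.
have f2 : 4 * (x * W q) <= 2 * A q + 35 / 32 * D q by lra.
have g1 : x * (x * W q) <= 4.
  have : x * (4 * (x * W q)) <= x * (2 * A q + 35 / 32 * D q) by rewrite ler_wpM2l.
  have -> : x * (2 * A q + 35 / 32 * D q) = 2 * (x * A q) + 35 / 32 * (x * D q) by ring.
  have : D q * (2 * x) <= D q * 1 by rewrite ler_wpM2l.
  have : x * (4 * (x * W q)) = 4 * (x ^+ 2 * W q) by ring.
  have -> : x * (x * W q) = x ^+ 2 * W q by ring.
  move: (x ^+ 2 * W q) xxA f0 f1 h2 => w *; lra.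
have g1' : x ^+ 2 * W q <= 4 by rewrite expr2 -mulrA.
lra.
Qed.
End energy.

(** * Sums of squares, symmetric differences and elementary symmetric functions *)

Section sumlemmas.
Variable R : realFieldType.

(** The quadratic polynomial sum (t a_i + b_i)^2 in t is nonnegative; it is
    evaluated at its minimum t = - Y / X. *)
Lemma cauchy_schwarz_sum (I : finType) (P : pred I) (a b : I -> R) :
  (\sum_(i | P i) a i * b i) ^+ 2 <=
  (\sum_(i | P i) a i ^+ 2) * (\sum_(i | P i) b i ^+ 2).
Proof.
set X := \sum_(i | P i) a i ^+ 2; set Y := \sum_(i | P i) a i * b i.
set Z := \sum_(i | P i) b i ^+ 2.
have H t : 0 <= t ^+ 2 * X + 2 * t * Y + Z.
  rewrite /X /Y /Z !mulr_sumr -!big_split /=; apply: sumr_ge0 => i _.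
  have -> : t ^+ 2 * a i ^+ 2 + 2 * t * (a i * b i) + b i ^+ 2 = (t * a i + b i) ^+ 2.
    by ring.
  exact: sqr_ge0.
have X0 : 0 <= X by apply: sumr_ge0 => i _; exact: sqr_ge0.
have [X00|Xn0] := eqVneq X 0.
  have -> : Y = 0.
    rewrite /Y big1// => i Pi.
    have := psumr_eq0P (fun i _ => sqr_ge0 (a i)) X00 Pi.
    by move/eqP; rewrite sqrf_eq0 => /eqP ->; rewrite mul0r.
  by rewrite X00 expr0n mul0r.
have {}X0 : 0 < X by rewrite lt_neqAle eq_sym Xn0.
have := mulr_ge0 (ltW X0) (H (- Y / X)).
have -> : X * ((- Y / X) ^+ 2 * X + 2 * (- Y / X) * Y + Z) = X * Z - Y ^+ 2 by field.
by rewrite subr_ge0.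
Qed.

Lemma jensen_sq (I : finType) (P : pred I) (w a : I -> R) :
  (forall i, P i -> 0 <= w i) ->
  (\sum_(i | P i) w i * a i) ^+ 2 <=
  (\sum_(i | P i) w i) * (\sum_(i | P i) w i * a i ^+ 2).
Proof.
move=> w0.
set X := \sum_(i | P i) w i; set Y := \sum_(i | P i) w i * a i.
set Z := \sum_(i | P i) w i * a i ^+ 2.
have H t : 0 <= t ^+ 2 * X + 2 * t * Y + Z.
  rewrite /X /Y /Z !mulr_sumr -!big_split /=; apply: sumr_ge0 => i Pi.
  have -> : t ^+ 2 * w i + 2 * t * (w i * a i) + w i * a i ^+ 2 = w i * (t + a i) ^+ 2.
    by ring.
  by rewrite mulr_ge0 ?sqr_ge0 ?w0.
have X0 : 0 <= X by exact: sumr_ge0.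
have [X00|Xn0] := eqVneq X 0.
  have -> : Y = 0.
    rewrite /Y big1// => i Pi.
    by rewrite (psumr_eq0P w0 X00 Pi) mul0r.
  by rewrite X00 expr0n mul0r.
have {}X0 : 0 < X by rewrite lt_neqAle eq_sym Xn0.
have := mulr_ge0 (ltW X0) (H (- Y / X)).
have -> : X * ((- Y / X) ^+ 2 * X + 2 * (- Y / X) * Y + Z) = X * Z - Y ^+ 2 by field.
by rewrite subr_ge0.
Qed.

Lemma sq_sum_le (I : finType) (P : pred I) (a : I -> R) :
  (\sum_(i | P i) a i) ^+ 2 <= (\sum_(i | P i) 1) * \sum_(i | P i) a i ^+ 2.
Proof.
have -> : \sum_(i | P i) a i = \sum_(i | P i) 1 * a i.
  by apply: eq_bigr => i _; rewrite mul1r.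
have -> : \sum_(i | P i) a i ^+ 2 = \sum_(i | P i) 1 * a i ^+ 2.
  by apply: eq_bigr => i _; rewrite mul1r.
exact: (@jensen_sq I P (fun=> 1)).
Qed.

End sumlemmas.

(** The group law of the cube, whose points are represented as sets. *)
Definition symdiff (T : finType) (A B : {set T}) := (A :\: B) :|: (B :\: A).

Section symdiff.
Variable T : finType.
Implicit Types A B C : {set T}.

Lemma in_symdiff A B x : (x \in symdiff A B) = (x \in A) (+) (x \in B).
Proof. by rewrite !inE; case: (x \in A); case: (x \in B). Qed.

Lemma symdiffC A B : symdiff A B = symdiff B A.
Proof. by apply/setP => x; rewrite !in_symdiff addbC. Qed.

Lemma symdiffA A B C : symdiff A (symdiff B C) = symdiff (symdiff A B) C.
Proof. by apply/setP => x; rewrite !in_symdiff addbA. Qed.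

Lemma symdiff0 A : symdiff A set0 = A.
Proof. by apply/setP => x; rewrite in_symdiff inE addbF. Qed.

Lemma sym0diff A : symdiff set0 A = A.
Proof. by rewrite symdiffC symdiff0. Qed.

Lemma symdiffK A : involutive (fun B => symdiff B A).
Proof. by move=> B; apply/setP => x; rewrite !in_symdiff addbK. Qed.

Lemma symKdiff A : involutive (symdiff A).
Proof. by move=> B; rewrite -[LHS]symdiffC [symdiff A B]symdiffC symdiffK. Qed.

Lemma symdiffxx A : symdiff A A = set0.
Proof. by apply/setP => x; rewrite in_symdiff inE addbb. Qed.

Lemma sum_symdiff (V : nmodType) (A : {set T}) (F : {set T} -> V) :
  \sum_I F (symdiff I A) = \sum_I F I.
Proof. by rewrite [RHS](reindex_inj (inv_inj (@symdiffK A))). Qed.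

End symdiff.

Section layers.
Variable T : finType.
Implicit Types A H : {set T}.

Definition layer A n := [set H : {set T} | (H \subset A) && (#|H| == n)].

Lemma card_layer A n : #|layer A n| = 'C(#|A|, n).
Proof. exact: cards_draws. Qed.

Lemma layer0 A : layer A 0 = [set set0].
Proof.
apply/setP => H; rewrite !inE cards_eq0; case: eqP => [->|]; rewrite ?andbF//.
by rewrite sub0set.
Qed.

Lemma layer_set0 n : layer set0 n.+1 = set0.
Proof.
apply/setP => H; rewrite !inE subset0; case: eqP => //= ->.
by rewrite cards0.
Qed.

(** The sets of size n+1 in j |: A either avoid j or arise from a set of size n
    by adding j. *)
Lemma sum_layerU1 (V : nmodType) (j : T) A n (F : {set T} -> V) : j \notin A ->
  \sum_(H in layer (j |: A) n.+1) F H =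
  \sum_(H in layer A n.+1) F H + \sum_(H in layer A n) F (j |: H).
Proof.
move=> jA; rewrite (bigID (fun H : {set T} => j \in H)) /= addrC; congr (_ + _).
  apply: eq_bigl => H; rewrite !inE -andbA; apply/idP/idP.
    move=> /and3P[/subsetP s -> jH]; rewrite andbT; apply/subsetP => x xH.
    by have := s _ xH; rewrite !inE; case: eqP => // xj; rewrite -xj xH in jH.
  move=> /andP[s ->]; rewrite (subset_trans s (subsetUr _ _)) /=.
  by apply: contra jA; exact: (subsetP s).
rewrite (reindex_onto (fun H => j |: H) (fun H => H :\ j)) /=; last first.
  by move=> H /andP[_ jH]; rewrite setD1K.
apply: eq_bigl => H; rewrite !inE eqxx /= andbT.
case jH: (j \in H); last first.
  rewrite setU1K ?jH// eqxx andbT cardsU1 jH eqSS; congr (_ && _).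
  rewrite subUset sub1set setU11 /=.
  apply/idP/idP => [/subsetP s|/subset_trans->//]; last exact: subsetUr.
  apply/subsetP => x xH; have := s _ xH; rewrite !inE.
  by case: eqP => // xj; rewrite -xj xH in jH.
have -> : (H \subset A) = false.
  by apply/negbTE; apply: contra jA => /subsetP; apply.
rewrite andbC /=; case: eqP => // e; have := setD11 j (j |: H).
by rewrite e jH.
Qed.
End layers.

Section elementary.
Variables (R : realFieldType) (T : finType) (c : T -> R).
Hypothesis c2 : forall j, c j * c j = 1.

(** The elementary symmetric function of the values of [c] on A. *)
Definition elem_sym (A : {set T}) n := \sum_(H in layer A n) \prod_(j in H) c j.

Lemma elem_sym0 (A : {set T}) : elem_sym A 0 = 1.
Proof. by rewrite /elem_sym layer0 big_set1 big_set0. Qed.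

Lemma elem_sym_set0 n : elem_sym set0 n.+1 = 0.
Proof. by rewrite /elem_sym layer_set0 big_set0. Qed.

Lemma elem_symU1 j (A : {set T}) n : j \notin A ->
  elem_sym (j |: A) n.+1 = elem_sym A n.+1 + c j * elem_sym A n.
Proof.
move=> jA; rewrite /elem_sym sum_layerU1// mulr_sumr; congr (_ + _).
apply: eq_bigr => H; rewrite inE => /andP[/subsetP s _].
by rewrite big_setU1//; apply: contra jA; exact: s.
Qed.

(** For signs, multiplying a product over H by c_j adds j to H or removes it,
    according to whether j lies in H: a set of size n+2 is reached in n+2 ways,
    one of size n in |A| - n ways.  Formally, both sides obey the same Pascal
    rule when an element is added to A. *)
Lemma elem_sym_rec (A : {set T}) n :
  (\sum_(j in A) c j) * elem_sym A n.+1 =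
    n.+2%:R * elem_sym A n.+2 + (#|A|%:R - n%:R) * elem_sym A n
  /\ (\sum_(j in A) c j) * elem_sym A 0 = elem_sym A 1.
Proof.
move: {2}#|A| (erefl #|A|) => m; elim: m A n => [|m IH] A n.
  move=> /eqP; rewrite cards_eq0 => /eqP ->; rewrite big_set0 !mul0r !elem_sym_set0 mulr0.
  case: n => [|n]; rewrite ?elem_sym_set0 ?mulr0 ?addr0//.
  by rewrite cards0 subrr mul0r addr0.
have [->|[j jA]] := set_0Vmem A; first by rewrite cards0.
rewrite -(setD1K jA); set B := A :\ j; have jB : j \notin B by rewrite setD11.
rewrite cardsU1 jB add1n => /eqP; rewrite eqSS => /eqP mB.
rewrite big_setU1//= !elem_symU1// !elem_sym0.
have cj := c2 j; have [IHn IH0] := IH B n mB.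
split; last by rewrite elem_sym0 in IH0; rewrite -IH0; ring.
have {IHn} := IHn; set s := \sum_(i in B) c i.
rewrite mB -(natr1 m) => e1.
case: n e1 => [|n] e1.
  rewrite !elem_sym0 in e1 IH0 *.
  have -> : (c j + s) * (elem_sym B 1 + c j * 1) =
    s * elem_sym B 1 + c j * elem_sym B 1 + c j * (s * 1) + c j * c j by ring.
  by rewrite e1 IH0 cj; ring.
have [e2 _] := IH B n mB.
rewrite elem_symU1//; move: e1 e2; rewrite -/s mB.
move: (elem_sym B n.+3) (elem_sym B n.+2) (elem_sym B n.+1) (elem_sym B n) => x3 x2 x1 x0 e1 e2.
have -> : (c j + s) * (x2 + c j * x1) =
  s * x2 + c j * (s * x1) + c j * x2 + (c j * c j) * x1 by ring.
rewrite e1 e2 cj -[n.+3%:R]natr1 -[n.+2%:R]natr1 -[n.+1%:R]natr1.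
by ring.
Qed.
End elementary.

(** * Walsh analysis and the square function on the cube *)

(** Here p = 1 - 2x is the eigenvalue of the averaging over one flip.  Steps of
    length two are bounded by two steps of length one. *)
Lemma two_step_bound_pos (R : realFieldType) (s p : R) (u : nat -> R) (q : nat) :
  0 <= s -> 0 <= p -> p <= 1 -> 32 * (q.+1%:R * s) <= 1 ->
  (forall n, u n ^+ 2 <= 1) ->
  (forall n, (n < q.+1)%N ->
    (1 - n%:R * s) * u n.+1 + n%:R * s * u n.-1 = p * u n) ->
  \sum_(n < q) n.+1%:R * (u n.+2 - u n) ^+ 2 <= 100.
Proof.
move=> s0 p0 p1 qs u1 rec.
have x0 : 0 <= (1 - p) / 2 by lra.
have x1 : 2 * ((1 - p) / 2) <= 1 by lra.
have H := energy_bound s0 x0 x1 qs u1.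
have {}H : \sum_(n < q.+1) n.+1%:R * (u n.+1 - u n) ^+ 2 <= 25.
  by apply: H => n nq; have := rec n nq; lra.
set v := fun n => n.+1%:R * (u n.+1 - u n) ^+ 2 in H *.
have v0 n : 0 <= v n by rewrite /v mulr_ge0 ?sqr_ge0.
have H1 : \sum_(n < q) v n.+1 <= 25.
  apply: le_trans H; rewrite big_ord_recl /= lerDr; exact: v0.
have H2 : \sum_(n < q) v n <= 25.
  by apply: le_trans H; rewrite big_ord_recr /= lerDl; exact: v0.
apply: (@le_trans _ _ (2 * \sum_(n < q) v n.+1 + 2 * \sum_(n < q) v n)); last by lra.
rewrite !mulr_sumr -big_split /=; apply: ler_sum => n _; rewrite /v.
rewrite -[n.+2%:R]natr1; have n0 : 0 <= (n.+1%:R : R) by [].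
move: (n.+1%:R : R) (u n.+2) (u n.+1) (u n) n0 => t a b c t0.
have k1 : (a - c) ^+ 2 <= 2 * (a - b) ^+ 2 + 2 * (b - c) ^+ 2.
  by have := sqr_ge0 (a - 2 * b + c); lra.
have := ler_wpM2l t0 k1; have := sqr_ge0 (a - b); lra.
Qed.

(** For negative p, the sequence (-1)^n u_n satisfies the recurrence with - p and
    has the same two-step differences: this is why differences of length two
    are used. *)
Lemma two_step_bound (R : realFieldType) (s p : R) (u : nat -> R) (q : nat) :
  0 <= s -> -1 <= p -> p <= 1 -> 32 * (q.+1%:R * s) <= 1 ->
  (forall n, u n ^+ 2 <= 1) ->
  (forall n, (n < q.+1)%N ->
    (1 - n%:R * s) * u n.+1 + n%:R * s * u n.-1 = p * u n) ->
  \sum_(n < q) n.+1%:R * (u n.+2 - u n) ^+ 2 <= 100.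
Proof.
move=> s0 p0 p1 qs u1 rec.
have [pp|pn] := leP 0 p; first exact: (@two_step_bound_pos _ s p).
pose w n := (-1) ^+ n * u n.
have wu n : (w n.+2 - w n) ^+ 2 = (u n.+2 - u n) ^+ 2.
  by rewrite /w -[(-1) ^+ n.+2]signr_odd /= negbK signr_odd -mulrBr exprMn
    sqrr_sign mul1r.
rewrite -(eq_bigr _ (fun (n : 'I_q) _ => congr1 (fun z => n.+1%:R * z) (wu n))).
apply: (@two_step_bound_pos _ s (- p)) => //; [by lra|by lra| |].
  by move=> n; rewrite /w exprMn sqrr_sign mul1r.
move=> n nq; have := rec n nq; rewrite /w.
case: n nq => [|n] nq /=; rewrite ?mul0r ?mul0r.
  by rewrite !expr0 expr1 !mul1r; lra.
rewrite !exprS; move: ((-1) ^+ n : R) => e h.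
have -> : (1 - n.+1%:R * s) * (-1 * (-1 * e) * u n.+2) + n.+1%:R * s * (e * u n) =
  e * ((1 - n.+1%:R * s) * u n.+2 + n.+1%:R * s * u n) by ring.
by rewrite h; ring.
Qed.

Section walsh.
Variables (R : realFieldType) (T : finType).
Implicit Types (A H I Q : {set T}) (F G : {set T} -> R).

Definition walsh_sign Q j : R := (-1) ^+ (j \in Q).
Definition walsh Q H : R := \prod_(j in H) walsh_sign Q j.

Lemma walsh_sign2 Q j : walsh_sign Q j * walsh_sign Q j = 1.
Proof. by rewrite -expr2 sqrr_sign. Qed.

Lemma walsh_symdiff Q H I : walsh Q (symdiff H I) = walsh Q H * walsh Q I.
Proof.
rewrite /walsh ![\prod_(_ in _) _]big_mkcond -big_split /=; apply: eq_bigr => j _.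
rewrite in_symdiff; case: (j \in H); case: (j \in I); rewrite ?mul1r ?mulr1//=.
by rewrite walsh_sign2.
Qed.

Lemma walsh_sq Q H : walsh Q H ^+ 2 = 1.
Proof.
rewrite expr2 -walsh_symdiff symdiffxx /walsh big_set0//.
Qed.

Lemma walsh0 Q : walsh Q set0 = 1.
Proof. by rewrite /walsh big_set0. Qed.

Lemma walshC Q H : walsh Q H = walsh H Q.
Proof.
rewrite /walsh ![\prod_(_ in _) _]big_mkcond; apply: eq_bigr => j _ /=.
by rewrite /walsh_sign; case: (j \in H); case: (j \in Q).
Qed.

(** Toggling an element of H in Q changes the sign of the character. *)
Lemma sum_walsh H : \sum_Q walsh Q H = (H == set0)%:R * 2 ^+ #|T|.
Proof.
have [->|[j jH]] := set_0Vmem H.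
  rewrite eqxx mul1r (eq_bigr (fun=> 1)) => [|Q _]; last exact: walsh0.
  have -> : \sum_(Q : {set T}) (1 : R) = \sum_(Q in powerset [set: T]) 1.
    by apply: eq_bigl => Q; rewrite inE subsetT.
  by rewrite sumr_const card_powerset cardsT natrX.
have -> : (H == set0) = false by apply/negbTE/set0Pn; exists j.
rewrite mul0r.
set S := \sum_Q _; have : S = - S.
  rewrite {1}/S -(sum_symdiff [set j]) -sumrN; apply: eq_bigr => Q _.
  rewrite walshC walsh_symdiff walshC [X in _ * X]walshC -[RHS]mulrN1; congr (_ * _).
  rewrite /walsh (big_setD1 j)//= /walsh_sign inE eqxx big1 ?mulr1// => i.
  by rewrite !inE => /andP[/negbTE ->].
by move=> e; lra.
Qed.

Definition walsh_coef F Q := \sum_I F I * walsh Q I.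

(** Expanding the square, sum_walsh keeps only the diagonal. *)
Lemma parseval F : \sum_Q (walsh_coef F Q) ^+ 2 = 2 ^+ #|T| * \sum_I (F I) ^+ 2.
Proof.
pose S := \sum_I \sum_J F I * F J * \sum_Q walsh Q (symdiff I J).
transitivity S.
  under eq_bigr do rewrite /walsh_coef expr2 mulr_suml.
  rewrite exchange_big /=; apply: eq_bigr => I _.
  under eq_bigr do rewrite mulr_sumr.
  rewrite exchange_big /=; apply: eq_bigr => J _.
  rewrite mulr_sumr; apply: eq_bigr => Q _; rewrite walsh_symdiff; ring.
rewrite mulr_sumr; apply: eq_bigr => I _.
rewrite (bigD1 I)//= sum_walsh symdiffxx eqxx mul1r big1 ?addr0 => [|J JI].
  by rewrite mulrC expr2.
rewrite sum_walsh; case: eqP => [e|]; last by rewrite mul0r mulr0.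
by rewrite -(symKdiff I J) e symdiff0 eqxx in JI.
Qed.

Lemma walsh_coef_shift F H Q :
  walsh_coef (fun I => F (symdiff I H)) Q = walsh Q H * walsh_coef F Q.
Proof.
rewrite /walsh_coef -(sum_symdiff H) mulr_sumr; apply: eq_bigr => I _.
by rewrite symdiffK walsh_symdiff; ring.
Qed.

Definition layer_avg A n F I : R :=
  'C(#|A|, n)%:R^-1 * \sum_(H in layer A n) F (symdiff I H).

(** The eigenvalue of [layer_avg A n] on the character indexed by Q: a normalised
    Krawtchouk polynomial evaluated at |Q :&: A|. *)
Definition krawtchouk A Q n : R := 'C(#|A|, n)%:R^-1 * elem_sym (walsh_sign Q) A n.

Lemma walsh_coef_layer_avg A n F Q :
  walsh_coef (layer_avg A n F) Q = krawtchouk A Q n * walsh_coef F Q.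
Proof.
rewrite {1}/walsh_coef /layer_avg.
under eq_bigr do rewrite -mulrA mulr_suml.
rewrite -mulr_sumr exchange_big /= /krawtchouk /elem_sym -mulrA mulr_suml; congr (_ * _).
by apply: eq_bigr => H _; rewrite -walsh_coef_shift.
Qed.

Lemma krawtchouk_sq_le1 A Q n : krawtchouk A Q n ^+ 2 <= 1.
Proof.
rewrite /krawtchouk /elem_sym exprMn.
have [C0|Cn0] := eqVneq ('C(#|A|, n)%:R : R) 0.
  by rewrite C0 invr0 expr0n mul0r.
rewrite exprVn mulrC ler_pdivrMr ?exprn_even_gt0 ?mul1r//.
have := cauchy_schwarz_sum (fun H => H \in layer A n) (fun=> 1) (fun H => walsh Q H).
rewrite (eq_bigr _ (fun H _ => mul1r _)) => /le_trans; apply.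
rewrite [X in _ * X](eq_bigr (fun=> 1)) => [|H _]; last exact: walsh_sq.
by rewrite (eq_bigr (fun=> 1)) ?expr1n// sumr_const card_layer expr2.
Qed.

(** elem_sym_rec divided by the binomial coefficients. *)
Lemma krawtchouk_rec A Q n : (n < #|A|)%N ->
  (1 - n%:R * #|A|%:R^-1) * krawtchouk A Q n.+1 + n%:R * #|A|%:R^-1 * krawtchouk A Q n.-1
  = (\sum_(j in A) walsh_sign Q j) / #|A|%:R * krawtchouk A Q n.
Proof.
move=> nA; have m0 : (#|A|%:R : R) != 0 by rewrite pnatr_eq0; lia.
have Cn0 k : (k <= #|A|)%N -> ('C(#|A|, k)%:R : R) != 0.
  by move=> h; rewrite pnatr_eq0 -lt0n bin_gt0.
have binE k : (k <= #|A|)%N ->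
    k.+1%:R * 'C(#|A|, k.+1)%:R = (#|A|%:R - k%:R) * 'C(#|A|, k)%:R :> R.
  by move=> h; rewrite -natrM mul_bin_left natrM natrB.
have [e1 e0] := elem_sym_rec (walsh_sign2 Q) A n.-1.
rewrite /krawtchouk; case: n nA e1 => [|n] nA /= e1.
  rewrite bin0 bin1 !mul0r subr0 addr0 mul1r -e0 invr1 elem_sym0.
  by field.
apply: (mulfI m0); set p := \sum_(j in A) _ in e1 *.
have -> : #|A|%:R * (p / #|A|%:R * ('C(#|A|, n.+1)%:R^-1 * elem_sym (walsh_sign Q) A n.+1)) =
  'C(#|A|, n.+1)%:R^-1 * (p * elem_sym (walsh_sign Q) A n.+1).
  by field; rewrite m0 Cn0//; lia.
rewrite e1.
have h2 := binE n.+1 (ltnW nA); have h1 := binE n (ltnW (ltnW nA)).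
have c0 := Cn0 n (ltnW (ltnW nA)); have c1 := Cn0 n.+1 (ltnW nA).
have c2 := Cn0 n.+2 nA.
move: (#|A|%:R : R) ('C(#|A|, n)%:R : R) ('C(#|A|, n.+1)%:R : R) ('C(#|A|, n.+2)%:R : R)
  (elem_sym _ A n.+2) (elem_sym _ A n) m0 c0 c1 c2 h1 h2 => m C0 C1 C2 x y m0 c0 c1 c2 h1 h2.
have k1 : n.+2%:R / C1 = (m - n.+1%:R) / C2 :> R.
  by apply/eqP; rewrite eqr_div//; apply/eqP.
have k0 : (m - n%:R) / C1 = n.+1%:R / C0 :> R.
  by apply/eqP; rewrite eqr_div//; apply/eqP; rewrite -h1.
have -> : C1^-1 * (n.+2%:R * x + (m - n%:R) * y) =
  (n.+2%:R / C1) * x + ((m - n%:R) / C1) * y by ring.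
rewrite k1 k0.
by field; rewrite m0 c0 c2.
Qed.

(** By Parseval the left side is a combination of the squared Walsh coefficients
    of F, with the multipliers bounded by two_step_bound. *)
Lemma square_function A q F : (32 * q.+1 <= #|A|)%N ->
  \sum_(n < q) n.+1%:R * \sum_I (layer_avg A n.+2 F I - layer_avg A n F I) ^+ 2
   <= 100 * \sum_I (F I) ^+ 2.
Proof.
move=> qA.
have N0 : 0 < 2 ^+ #|T| :> R by rewrite exprn_gt0.
rewrite -(ler_pM2l N0) [X in X <= _]mulr_sumr.
have -> : \sum_(n < q) 2 ^+ #|T| *
      (n.+1%:R * \sum_I (layer_avg A n.+2 F I - layer_avg A n F I) ^+ 2)
  = \sum_Q (\sum_(n < q) n.+1%:R *
      (krawtchouk A Q n.+2 - krawtchouk A Q n) ^+ 2) * (walsh_coef F Q) ^+ 2.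
  under [RHS]eq_bigr do rewrite mulr_suml.
  rewrite [RHS]exchange_big /=; apply: eq_bigr => n _.
  rewrite mulrCA -parseval mulr_sumr; apply: eq_bigr => Q _.
  rewrite -mulrA -exprMn mulrBl -!walsh_coef_layer_avg /walsh_coef -sumrB.
  congr (_ * _); congr (_ ^+ _); apply: eq_bigr => I _; exact: mulrBl.
have -> : 2 ^+ #|T| * (100 * \sum_I F I ^+ 2) = \sum_Q 100 * (walsh_coef F Q) ^+ 2.
  by rewrite mulrCA -parseval mulr_sumr.
apply: ler_sum => Q _; apply: ler_wpM2r; first exact: sqr_ge0.
have m0 : 0 < (#|A|%:R : R) by rewrite ltr0n; lia.
apply: (@two_step_bound _ #|A|%:R^-1 ((\sum_(j in A) walsh_sign Q j) / #|A|%:R)).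
- by rewrite invr_ge0.
- rewrite ler_pdivlMr// mulN1r -[#|A|]sum1_card natr_sum -sumrN.
  by apply: ler_sum => j _; rewrite /walsh_sign; case: (j \in Q); rewrite ?expr1 ?expr0//=; lra.
- rewrite ler_pdivrMr// mul1r -[#|A|]sum1_card natr_sum.
  by apply: ler_sum => j _; rewrite /walsh_sign; case: (j \in Q); rewrite ?expr1 ?expr0//=; lra.
- by rewrite mulrA ler_pdivrMr// mul1r -natrM ler_nat.
- by move=> n; exact: krawtchouk_sq_le1.
- by move=> n nq; apply: krawtchouk_rec; lia.
Qed.

End walsh.

(** * Doob's inequality and random chains of subsets *)

Section doob.
Variables (R : realFieldType) (T : finType).
Implicit Types (A H I J : {set T}) (F G : {set T} -> R).

(** The conditional expectation given the coordinates outside J: the sets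
    [symdiff I H] with H \subset J are those that agree with I off J. *)
Definition cond_avg J F I : R :=
  (2 ^+ #|J|)^-1 * \sum_(H : {set T} | H \subset J) F (symdiff I H).

Lemma cond_avg_ge0 J F I : (forall I, 0 <= F I) -> 0 <= cond_avg J F I.
Proof. by move=> F0; rewrite mulr_ge0 ?invr_ge0 ?exprn_ge0 ?sumr_ge0. Qed.

Lemma cond_avg_adj J F G : \sum_I G I * cond_avg J F I = \sum_I cond_avg J G I * F I.
Proof.
rewrite /cond_avg.
under eq_bigr do rewrite mulrCA mulr_sumr.
under [RHS]eq_bigr do rewrite -mulrA mulr_suml.
rewrite -!mulr_sumr; congr (_ * _).
rewrite exchange_big [RHS]exchange_big /=; apply: eq_bigr => H _.
by rewrite -(sum_symdiff H); apply: eq_bigr => I _; rewrite symdiffK.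
Qed.

Lemma symdiff_subset H H' J : H \subset J -> H' \subset J -> symdiff H H' \subset J.
Proof.
by move=> /subsetP h /subsetP h'; apply/subsetP => x; rewrite in_symdiff;
  case xH: (x \in H); case xH': (x \in H') => // _; [exact: h|exact: h'].
Qed.

Lemma cond_avg_inv J F I H : H \subset J -> cond_avg J F (symdiff I H) = cond_avg J F I.
Proof.
move=> HJ; rewrite /cond_avg; congr (_ * _).
rewrite (reindex_inj (inv_inj (@symKdiff _ H))) /=; apply: eq_big => [H'|H' _].
  apply/idP/idP => h; last exact: symdiff_subset.
  by rewrite -(symKdiff H H'); exact: symdiff_subset.
by rewrite symdiffA symdiffK.
Qed.

Lemma cond_avg_nested J' J F I : J' \subset J -> cond_avg J' (cond_avg J F) I = cond_avg J F I.
Proof.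
move=> JJ; rewrite {1}/cond_avg (eq_bigr (fun=> cond_avg J F I)) => [|H HJ']; last first.
  by apply: cond_avg_inv; exact: subset_trans JJ.
rewrite sumr_const; have -> : #|[pred H : {set T} | H \subset J']| = (2 ^ #|J'|)%N.
  by rewrite -card_powerset; apply: eq_card => H; rewrite inE powersetE.
by rewrite -[cond_avg J F I *+ _]mulr_natl natrX mulKf// expf_neq0 ?pnatr_eq0//.
Qed.

(** The selector l linearises the maximal function of nested conditional
    averages.  Let g be the selected average of F and h = T^* g, where T is the
    selected averaging operator.  The product of two nested conditional averages
    is the one over the larger set, and g >= 0, so the sum over smaller indices can be
    completed: |h|^2 <= 2 <g, h>.  Hence |h| <= 2 |g|, and |g|^2 = <h, F> gives
    |g| <= 2 |F|. *)
Lemma doob_selector L (J : 'I_L -> {set T}) (l : {set T} -> 'I_L) F :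
  (forall i j : 'I_L, (i <= j)%N -> J i \subset J j) -> (forall I, 0 <= F I) ->
  \sum_I (cond_avg (J (l I)) F I) ^+ 2 <= 4 * \sum_I (F I) ^+ 2.
Proof.
move=> Jm F0; pose g I := cond_avg (J (l I)) F I.
have g0 I : 0 <= g I by exact: cond_avg_ge0.
pose gk k I := if l I == k then g I else 0.
have gk0 k I : 0 <= gk k I by rewrite /gk; case: ifP.
have gE I : g I = \sum_k gk k I.
  rewrite (bigD1 (l I))//= /gk eqxx big1 ?addr0// => k.
  by rewrite eq_sym => /negbTE ->.
pose h I := \sum_k cond_avg (J k) (gk k) I.
pose E k := cond_avg (J k) (gk k).
have E0 k I : 0 <= E k I by exact: cond_avg_ge0.
have YhF : \sum_I (g I) ^+ 2 = \sum_I h I * F I.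
  rewrite /h; under [RHS]eq_bigr do rewrite mulr_suml.
  rewrite exchange_big /=; under [RHS]eq_bigr do rewrite -cond_avg_adj.
  rewrite exchange_big /=; apply: eq_bigr => I _.
  rewrite (bigD1 (l I))//= big1 ?addr0 => [|k]; first by rewrite /gk eqxx expr2.
  by rewrite /gk eq_sym => /negbTE ->; rewrite mul0r.
(* The product of two nested conditional averages is the one over the larger set. *)
have Epair (k k' : 'I_L) : (k' <= k)%N ->
    \sum_I E k I * E k' I = \sum_I gk k' I * E k I.
  move=> kk; rewrite {2}/E cond_avg_adj; apply: eq_bigr => I _; rewrite mulrC.
  by rewrite /E cond_avg_nested// Jm.
have Xgh : \sum_I (h I) ^+ 2 <= 2 * \sum_I g I * h I.
  have -> : \sum_I (h I) ^+ 2 = \sum_k \sum_k' \sum_I E k I * E k' I.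
    rewrite /h; under eq_bigr do rewrite expr2 mulr_suml.
    rewrite exchange_big /=; apply: eq_bigr => k _.
    under eq_bigr do rewrite mulr_sumr.
    by rewrite exchange_big.
  have -> : 2 * \sum_I g I * h I =
     \sum_k \sum_k' (\sum_I gk k' I * E k I + \sum_I gk k I * E k' I).
    have e : \sum_I g I * h I = \sum_k \sum_k' \sum_I gk k' I * E k I.
      rewrite /h; under eq_bigr do rewrite mulr_sumr.
      rewrite exchange_big /=; apply: eq_bigr => k _; rewrite exchange_big /=.
      by apply: eq_bigr => I _; rewrite gE mulr_suml.
    under [RHS]eq_bigr do rewrite big_split /=.
    rewrite big_split /= -e [X in _ + X]exchange_big /= -e.
    by rewrite -mulr2n mulr_natl.
  apply: ler_sum => k _; apply: ler_sum => k' _.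
  have [kk|kk] := leqP k' k.
    by rewrite Epair// lerDl; apply: sumr_ge0 => I _; rewrite mulr_ge0.
  rewrite (eq_bigr (fun I => E k' I * E k I)) => [|I _]; last by rewrite mulrC.
  rewrite Epair 1?ltnW// lerDr.
  by apply: sumr_ge0 => I _; rewrite mulr_ge0.
have c1 := cauchy_schwarz_sum xpredT g h.
have c2 := cauchy_schwarz_sum xpredT h F.
rewrite -/(g _) -YhF in c2 *.
have gh0 : 0 <= \sum_I g I * h I.
  by apply: sumr_ge0 => I _; rewrite mulr_ge0 ?sumr_ge0// => k _; exact: E0.
have X0 : 0 <= \sum_I (h I) ^+ 2 by apply: sumr_ge0 => I _; exact: sqr_ge0.
have Y0 : 0 <= \sum_I (g I) ^+ 2 by apply: sumr_ge0 => I _; exact: sqr_ge0.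
have Z0 : 0 <= \sum_I (F I) ^+ 2 by apply: sumr_ge0 => I _; exact: sqr_ge0.
have cancel_sq (a b : R) : 0 <= a -> 0 <= b -> a ^+ 2 <= a * b -> a <= b.
  move=> a0 b0; rewrite expr2; have [->//|an0] := eqVneq a 0.
  by rewrite ler_pM2l// lt_neqAle eq_sym an0.
change (\sum_I (g I) ^+ 2 <= 4 * \sum_I F I ^+ 2).
move: (\sum_I g I * h I) (\sum_I (h I) ^+ 2) (\sum_I (g I) ^+ 2)
  (\sum_I F I ^+ 2) Xgh c1 c2 gh0 X0 Y0 Z0 => p X Y Z Xgh c1 c2 gh0 X0 Y0 Z0.
have XY : X <= 4 * Y.
  apply: cancel_sq => //; first by rewrite mulr_ge0.
  have : X ^+ 2 <= (2 * p) ^+ 2 by rewrite ler_sqr ?nnegrE// mulr_ge0.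
  by rewrite exprMn; lra.
apply: cancel_sq => //; first by rewrite mulr_ge0.
by apply: le_trans c2 _; have := ler_wpM2r Z0 XY; lra.
Qed.

End doob.

(** The lists of values of f and of g are permutations of each other. *)
Lemma fiber_perm (T : finType) (L : eqType) (f g : T -> L) :
  (forall y, #|[pred x | f x == y]| = #|[pred x | g x == y]|) ->
  exists p : {perm T}, forall x, f x = g (p x).
Proof.
move=> fg.
have /tuple_permP[p /= e] : perm_eq (map_tuple f (enum_tuple T)) (map_tuple g (enum_tuple T)).
  apply/allP => y _ /=; rewrite !count_map; apply/eqP.
  have H (k : T -> L) : count (preim k (pred1 y)) (enum T) = #|[pred x | k x == y]|.
    by rewrite cardE -size_filter /enum_mem filter_predT; congr size; apply: eq_filter.
  by have := fg y; rewrite -!H enumT.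
have inj : injective (fun x => enum_val (p (enum_rank x))).
  by move=> x y /enum_val_inj/perm_inj/enum_rank_inj.
exists (perm inj) => x; rewrite permE.
have := congr1 (fun s => nth (f x) s (enum_rank x)) e.
rewrite -[LHS]/(nth (f x) (map f (enum T)) (enum_rank x)) (nth_map x); last first.
  by rewrite -cardE.
rewrite nth_enum_rank => {1}->.
rewrite (nth_map (enum_rank x)) ?size_enum_ord// nth_ord_enum tnth_map.
rewrite (tnth_nth x) /= /enum_val; congr g; apply: set_nth_default.
by rewrite -cardE.
Qed.

Section perm_average.
Variables (R : realFieldType) (T : finType).
Implicit Types (A H I J : {set T}) (F : {set T} -> R).

Definition stab_perm A := [set s : {perm T} | s @: A == A].

Lemma stab_perm1 A : (0 < #|stab_perm A|)%N.
Proof.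
apply/card_gt0P; exists 1%g; rewrite inE.
by rewrite (eq_imset _ (@perm1 T)) imset_id.
Qed.

(** Label each point by whether it lies in A and whether it lies in the given set;
    the labels of H and of H' have the same fibre cardinalities. *)
Lemma layer_transitive A n H H' : H \in layer A n -> H' \in layer A n ->
  exists2 s, s \in stab_perm A & H' = s @: H.
Proof.
rewrite !inE => /andP[HA /eqP cH] /andP[H'A /eqP cH'].
pose lab (X : {set T}) x := (x \in A, x \in X).
have cardlab (X : {set T}) y : X \subset A -> #|X| = n ->
    #|[pred x | lab X x == y]| =
    (if y.1 then if y.2 then n else #|A| - n else if y.2 then 0 else #|~: A|)%N.
  move=> XA cX; case: y => [[] []] /=.
  - rewrite -cX; apply: eq_card => x; rewrite !inE /lab xpair_eqE !eqb_id.
    by case xX: (x \in X); rewrite ?andbF// (subsetP XA).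
  - rewrite -cX -(cardsDS XA); apply: eq_card => x.
    by rewrite !inE /lab xpair_eqE eqb_id eqbF_neg andbC.
  - apply: eq_card0 => x; rewrite !inE /lab xpair_eqE eqb_id eqbF_neg.
    by case xX: (x \in X); rewrite ?andbF// (subsetP XA).
  - apply: eq_card => x; rewrite !inE /lab xpair_eqE !eqbF_neg.
    by case xA: (x \in A) => //=; apply/negbT/negP => /(subsetP XA); rewrite xA.
have [p pE] : exists p : {perm T}, forall x, lab H x = lab H' (p x).
  by apply: fiber_perm => y; rewrite !cardlab.
exists p.
  rewrite inE; apply/eqP/setP => x; apply/imsetP/idP => [[y yA ->]|xA].
    by have [<- _] := pE y.
  by exists (p^-1 x)%g; rewrite ?permKV//; have [-> _] := pE (p^-1 x)%g; rewrite permKV.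
apply/setP => x; apply/idP/imsetP => [xH|[y yH ->]]; last by have [_ <-] := pE y.
by exists (p^-1 x)%g; rewrite ?permKV//; have [_ ->] := pE (p^-1 x)%g; rewrite permKV.
Qed.

Lemma imset_comp_perm (s t : {perm T}) H : (t * s)%g @: H = s @: (t @: H).
Proof. by rewrite -imset_comp; apply: eq_imset => x; rewrite permM. Qed.

Lemma layer_imset A n (s : {perm T}) H : s \in stab_perm A ->
  (s @: H \in layer A n) = (H \in layer A n).
Proof.
rewrite !inE => /eqP sA; rewrite (card_imset _ (@perm_inj _ s)); congr (_ && _).
apply/idP/idP => [/subsetP h|h]; last by rewrite -sA; exact: imsetS.
apply/subsetP => x xH; have : s x \in s @: A by rewrite sA h// imset_f.
by move=> /imsetP[y yA /perm_inj ->].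
Qed.

(** By transitivity the left side is the same for all H in the layer, so it equals
    its mean over the layer, and each permutation preserves the layer. *)
Lemma perm_average A n F H : H \in layer A n ->
  \sum_(s in stab_perm A) F (s @: H) =
  #|stab_perm A|%:R * ('C(#|A|, n)%:R^-1 * \sum_(H' in layer A n) F H').
Proof.
move=> HL; pose V H := \sum_(s in stab_perm A) F (s @: H).
have VH H' : H' \in layer A n -> V H' = V H.
  move=> H'L; have [t tA e] := layer_transitive H'L HL.
  rewrite /V e [LHS](reindex_inj (mulgI t)) /=; apply: eq_big => [s|s _].
    rewrite !inE imset_comp_perm; move: tA; rewrite inE => /eqP ->.
    by [].
  by rewrite imset_comp_perm.
have Cn0 : ('C(#|A|, n)%:R : R) != 0.
  by rewrite -card_layer pnatr_eq0 -lt0n; apply/card_gt0P; exists H.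
apply: (mulfI Cn0); rewrite [RHS]mulrCA mulVKf//.
rewrite mulr_natl -[in LHS]card_layer -sumr_const -(eq_bigr _ VH) /V.
rewrite exchange_big /= mulr_natl -sumr_const; apply: eq_bigr => s sA.
rewrite [RHS](reindex_inj (imset_inj (@perm_inj _ s))) /=.
by apply: eq_bigl => H'; rewrite layer_imset.
Qed.

Lemma sum_subset_layer J (g : nat -> R) m : (#|J| < m)%N ->
  \sum_(H : {set T} | H \subset J) g #|H| = \sum_(n < m) 'C(#|J|, n)%:R * g n.
Proof.
move=> Jm; rewrite (partition_big (fun H : {set T} => inord #|H| : 'I_m.-1.+1) xpredT)//=.
have -> : \sum_(n < m) 'C(#|J|, n)%:R * g n = \sum_(n < m.-1.+1) 'C(#|J|, n)%:R * g n.
  by case: m Jm.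
apply: eq_bigr => n _; rewrite -card_layer mulr_natl -sumr_const.
apply: eq_big => [H|H /andP[HJ /eqP <-]].
  rewrite inE; case HJ: (H \subset J) => //=.
  rewrite -val_eqE /= inordK//; apply: leq_ltn_trans (subset_leq_card HJ) _.
  by case: m Jm {n}.
rewrite inordK//; apply: leq_ltn_trans (subset_leq_card HJ) _.
by case: m Jm {n}.
Qed.

(** Averaging over a random J of given size turns conditional averages into
    binomial mixtures of layer averages. *)
Lemma perm_average_cond_avg A J m F I : J \subset A -> (#|J| < m)%N ->
  \sum_(s in stab_perm A) cond_avg (s @: J) F I =
  #|stab_perm A|%:R * ((2 ^+ #|J|)^-1 * \sum_(n < m) 'C(#|J|, n)%:R * layer_avg A n F I).
Proof.
move=> JA Jm; rewrite -(sum_subset_layer (fun n => layer_avg A n F I) Jm) /cond_avg.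
rewrite (eq_bigr (fun s : {perm T} => (2 ^+ #|J|)^-1 *
   \sum_(H : {set T} | H \subset J) F (symdiff I (s @: H)))); last first.
  move=> s _; rewrite card_imset; last exact: perm_inj.
  congr (_ * _); rewrite (reindex_inj (imset_inj (@perm_inj _ s))) /=.
  apply: eq_bigl => H; apply/idP/idP; last exact: imsetS.
  move=> /subsetP h; apply/subsetP => x xH.
  have /imsetP[y yJ /perm_inj ->//] := h _ (imset_f s xH).
rewrite -mulr_sumr mulrCA; congr (_ * _).
rewrite exchange_big mulr_sumr /=; apply: eq_bigr => H HJ.
by rewrite (@perm_average A #|H| (fun H' => F (symdiff I H')))// inE eqxx (subset_trans HJ).
Qed.

End perm_average.

(** * The maximal function of layer averages *)

(** If f(k, L) is the sum of C(l, k) / 2^l over l < L, Pascal's rule gives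
    f(k+1, L+1) = (f(k+1, L) + f(k, L)) / 2; at L = 2n+2 the boundary terms
    cancel because C(2n+2, n+1) = 2 C(2n+1, n).  So the binomial laws of sizes at
    most 2n charge n with total mass one, and means of layer averages are
    dominated by means of conditional averages. *)
Lemma sum_bin_half (R : realFieldType) n :
  \sum_(l < n.*2.+1) 'C(l, n)%:R * (2 ^+ l)^-1 = 1 :> R.
Proof.
pose f k L : R := \sum_(l < L) 'C(l, k)%:R * (2 ^+ l)^-1.
have fS k L : f k L.+1 = f k L + 'C(L, k)%:R * (2 ^+ L)^-1.
  by rewrite /f big_ord_recr.
have pascal k L : f k.+1 L.+1 = (f k.+1 L + f k L) / 2.
  rewrite /f big_ord_recl bin0n mul0r add0r -big_split mulr_suml /=.
  apply: eq_bigr => l _; rewrite /bump /= add1n binS natrD exprS.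
  by rewrite invfM; lra.
rewrite -/(f n n.*2.+1); elim: n => [|n IH].
  by rewrite /f big_ord1 bin0 expr0 invr1 mulr1.
have := pascal n n.*2.+2; have := fS n n.*2.+1; have := fS n.+1 n.*2.+2.
rewrite doubleS binS -(@bin_sub n.*2.+1 n.+1); last by lia.
have -> : (n.*2.+1 - n.+1 = n)%N by lia.
have -> : 2 ^+ n.*2.+2 = 2 * 2 ^+ n.*2.+1 :> R by rewrite exprS.
rewrite invfM natrD IH.
move: (f _ _) (f _ _) (f _ _) ('C(_, _)%:R : R) ((2 ^+ _)^-1) => x y z c e.
lra.
Qed.

Lemma sum_alternate (R : realFieldType) (g : nat -> R) b r : (forall n, 0 <= g n) ->
  \sum_(i < r.+1) g (b + i.*2)%N <= \sum_(n < (b + r.*2).+1) g n.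
Proof.
move=> g0; elim: r => [|r IH].
  rewrite big_ord1 big_ord_recr /= lerDr; exact: sumr_ge0.
rewrite big_ord_recr /= doubleS !addnS 2!(big_ord_recr _.+1) /=.
by have := g0 (b + r.*2).+1; have := IH; lra.
Qed.

Lemma sum_widen (R : realFieldType) (g : nat -> R) m n : (forall n, 0 <= g n) ->
  (m <= n)%N -> \sum_(i < m) g i <= \sum_(i < n) g i.
Proof.
move=> g0 /subnK <-; rewrite addnC; elim: (n - m)%N => [|k IH]; first by rewrite addn0.
by rewrite addnS big_ord_recr /=; apply: le_trans IH _; rewrite lerDl.
Qed.

Lemma telescope_average (R : realFieldType) (a : nat -> R) r :
  r.+1%:R * a r = \sum_(i < r.+1) a i + \sum_(i < r) i.+1%:R * (a i.+1 - a i).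
Proof.
elim: r => [|r IH]; first by rewrite big_ord0 big_ord1 mul1r addr0.
rewrite big_ord_recr [X in _ = _ + X]big_ord_recr /=.
have := IH; rewrite -[r.+2%:R]natr1; lra.
Qed.

(** Let r be half of N and a_i the values of S at the indices of the parity of N.
    Then a_r is the mean of a_0, ..., a_r plus a weighted sum of steps
    (telescope_average).  The mean is at most 4 b, and Cauchy-Schwarz bounds the
    sum of steps by the square function. *)
Lemma tauberian (R : realFieldType) (S : nat -> R) (b : R) (N q : nat) :
  (forall n, 0 <= S n) -> 0 <= b -> (N <= q)%N ->
  \sum_(n < N.+1) S n <= (N.*2.+1)%:R * b ->
  S N ^+ 2 <= 32 * b ^+ 2 + 2 * \sum_(n < q) n.+1%:R * (S n.+2 - S n) ^+ 2.
Proof.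
move=> S0 b0 Nq Nb; pose p : nat := odd N; pose r := N./2.
have Nr : N = (p + r.*2)%N by rewrite odd_double_half.
pose a i := S (p + i.*2)%N.
have r0 : 0 < (r.+1%:R : R) by rewrite ltr0Sn.
pose P := \sum_(i < r.+1) a i; pose D := \sum_(i < r) i.+1%:R * (a i.+1 - a i).
have e : r.+1%:R * a r = P + D := telescope_average a r.
pose G := \sum_(n < q) n.+1%:R * (S n.+2 - S n) ^+ 2.
have P0 : 0 <= P by apply: sumr_ge0 => i _; exact: S0.
have hP : P <= r.+1%:R * (4 * b).
  apply: (@le_trans _ _ (N.*2.+1%:R * b)).
    by apply: le_trans Nb; rewrite [X in X.+1]Nr; apply: sum_alternate.
  by rewrite mulrA ler_wpM2r// -natrM ler_nat; rewrite Nr /p; case: (odd N); lia.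
have hD : D ^+ 2 <= r.+1%:R ^+ 2 * G.
  have w0 (i : 'I_r) : true -> 0 <= (i.+1%:R : R) by [].
  have := jensen_sq (fun i : 'I_r => a i.+1 - a i) w0; rewrite -/D => /le_trans; apply.
  have hw : \sum_(i < r) (i.+1%:R : R) <= r.+1%:R ^+ 2.
    apply: (@le_trans _ _ (\sum_(i < r) r.+1%:R)).
      by apply: ler_sum => i _; rewrite ler_nat; have := ltn_ord i; lia.
    rewrite sumr_const card_ord -[_ *+ _]mulr_natl expr2 ler_wpM2r//.
    by rewrite ler_nat.
  have hG : \sum_(i < r) i.+1%:R * (a i.+1 - a i) ^+ 2 <= G.
    pose g n := n.+1%:R * (S n.+2 - S n) ^+ 2.
    have g0 n : 0 <= g n by rewrite mulr_ge0 ?sqr_ge0.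
    apply: (@le_trans _ _ (\sum_(i < r) g (p + i.*2)%N)).
      apply: ler_sum => i _; rewrite /g /a doubleS !addnS ler_wpM2r ?sqr_ge0//.
      by rewrite ler_nat; lia.
    case: (r) Nr => [|r'] Nr.
      by rewrite big_ord0; apply: sumr_ge0 => n _; exact: g0.
    apply: le_trans (sum_alternate p r' g0) _.
    by apply: sum_widen => //; lia.
  apply: ler_pM => //; apply: sumr_ge0 => i _ //.
  by rewrite mulr_ge0 ?sqr_ge0.
have aN : a r = S N by rewrite /a -Nr.
rewrite -aN -/G; have r20 : 0 < r.+1%:R ^+ 2 :> R by rewrite exprn_gt0.
rewrite -(ler_pM2l r20) -exprMn e mulrDr.
have hP2 : P ^+ 2 <= (r.+1%:R * (4 * b)) ^+ 2.
  by rewrite ler_sqr ?nnegrE// !mulr_ge0.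
have -> : r.+1%:R ^+ 2 * (32 * b ^+ 2) = 2 * (r.+1%:R * (4 * b)) ^+ 2 by ring.
move: hP2 hD (sqr_ge0 (P - D)); move: ((r.+1%:R * (4 * b)) ^+ 2) => x h1 h2 h3.
by rewrite [X in _ <= _ + X]mulrCA; move: (r.+1%:R ^+ 2 * G) h2 => y h2; lra.
Qed.

Section cube_maximal.
Variables (R : realFieldType) (T : finType) (A : {set T}) (q : nat).
Variable F : {set T} -> R.
Hypothesis F0 : forall I, 0 <= F I.
Hypothesis qA : (32 * q.+1 <= #|A|)%N.

(** A fixed maximal chain of subsets of A. *)
Let J l := [set x in take l (enum A)].

Let cardJ l : (l <= #|A|)%N -> #|J l| = l.
Proof.
move=> lA; rewrite /J cardsE (card_uniqP _) ?take_uniq ?enum_uniq//.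
by rewrite size_takel// -cardE.
Qed.

Let JA l : J l \subset A.
Proof. by apply/subsetP => x; rewrite inE => /mem_take; rewrite mem_enum. Qed.

Let Jmono i j : (i <= j)%N -> J i \subset J j.
Proof.
move=> ij; apply/subsetP => x; rewrite !inE => xi.
by move: xi; rewrite -(take_takel (enum A) ij) => /mem_take.
Qed.

(** The average of conditional averages over all subsets of A of size l, as
    B_perm shows. *)
Let B l I := (2 ^+ l)^-1 * \sum_(n < q.*2.+1) 'C(l, n)%:R * layer_avg A n F I.

Lemma layer_avg_ge0 n I : 0 <= layer_avg A n F I.
Proof. by rewrite mulr_ge0 ?invr_ge0 ?ler0n ?sumr_ge0. Qed.

Let B0 l I : 0 <= B l I.
Proof.
rewrite mulr_ge0 ?invr_ge0 ?exprn_ge0 ?sumr_ge0// => n _.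
by rewrite mulr_ge0// layer_avg_ge0.
Qed.

Let sumB N I : (N <= q)%N ->
  \sum_(n < N.+1) layer_avg A n F I <= \sum_(l < N.*2.+1) B l I.
Proof.
move=> Nq; rewrite /B; under [X in _ <= X]eq_bigr do rewrite mulr_sumr.
rewrite exchange_big /=.
have h : \sum_(n < N.+1) layer_avg A n F I <=
  \sum_(n < N.+1) \sum_(l < N.*2.+1) (2 ^+ l)^-1 * ('C(l, n)%:R * layer_avg A n F I).
  apply: ler_sum => n _; have := layer_avg_ge0 n I => s0.
  rewrite -[X in X <= _]mul1r -[X in X * _ <= _](sum_bin_half R n) mulr_suml.
  under [X in _ <= X]eq_bigr do rewrite mulrA [_^-1 * _]mulrC.
  apply: (@sum_widen R (fun l => 'C(l, n)%:R / 2 ^+ l * layer_avg A n F I)) => [l|].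
    apply: mulr_ge0; last exact: layer_avg_ge0.
    by rewrite mulr_ge0 ?invr_ge0 ?exprn_ge0.
  by rewrite ltnS leq_double -ltnS.
apply: le_trans h _.
apply: (@sum_widen R (fun n =>
    \sum_(l < N.*2.+1) (2 ^+ l)^-1 * ('C(l, n)%:R * layer_avg A n F I))).
  move=> n; apply: sumr_ge0 => l _; apply: mulr_ge0.
    by rewrite invr_ge0 exprn_ge0.
  by rewrite mulr_ge0// layer_avg_ge0.
by rewrite ltnS; apply: leq_trans Nq _; rewrite -addnn leq_addr.
Qed.

Let B_perm l I : (l <= q.*2)%N ->
  #|stab_perm A|%:R * B l I = \sum_(s in stab_perm A) cond_avg (s @: J l) F I.
Proof.
move=> lq; have cJ : #|J l| = l by apply: cardJ; lia.
rewrite (@perm_average_cond_avg R T A (J l) q.*2.+1 F I)//; last by rewrite cJ ltnS.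
by rewrite cJ.
Qed.

(** B is an average, over the permutations of the coordinates that preserve A,
    of conditional averages along the permuted chain; Doob's inequality applies
    to each permutation. *)
Let B_selector (l : {set T} -> 'I_q.*2.+1) :
  \sum_I (B (l I) I) ^+ 2 <= 4 * \sum_I F I ^+ 2.
Proof.
have P0 : 0 < (#|stab_perm A|%:R : R) by rewrite ltr0n stab_perm1.
have P20 : 0 < (#|stab_perm A|%:R ^+ 2 : R) by rewrite exprn_gt0.
rewrite -(ler_pM2l P20) [X in X <= _]mulr_sumr.
have h I : #|stab_perm A|%:R ^+ 2 * B (l I) I ^+ 2 <=
   #|stab_perm A|%:R * \sum_(s in stab_perm A) cond_avg (s @: J (l I)) F I ^+ 2.
  rewrite -exprMn B_perm; last by rewrite -ltnS.
  by rewrite -sumr_const; exact: sq_sum_le.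
apply: (@le_trans _ _ (\sum_I #|stab_perm A|%:R *
    \sum_(s in stab_perm A) cond_avg (s @: J (l I)) F I ^+ 2)).
  by apply: ler_sum => I _; exact: h.
rewrite -mulr_sumr exchange_big /= expr2 -[X in _ <= X]mulrA ler_pM2l//.
rewrite [X in _ <= X]mulr_natl -sumr_const.
apply: ler_sum => s _; apply: (doob_selector (J := fun l : 'I_q.*2.+1 => s @: J l)) => //.
by move=> i j ij; apply: imsetS; exact: Jmono.
Qed.

(** The selector N linearises the maximal function; the selector l picks the
    largest conditional average, independently of N.  The constant is
    328 = 32 * 4 + 2 * 100. *)
Lemma cube_maximal (N : {set T} -> 'I_q.+1) :
  \sum_I (layer_avg A (N I) F I) ^+ 2 <= 328 * \sum_I F I ^+ 2.
Proof.
pose l I : 'I_q.*2.+1 := [arg max_(l > (ord0 : 'I_q.*2.+1)) B l I]%O.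
have Bl I (k : 'I_q.*2.+1) : B k I <= B (l I) I.
  rewrite /l; case: (@Order.TotalTheory.arg_maxP _ _ _ (ord0 : 'I_q.*2.+1) xpredT
    (fun l : 'I_q.*2.+1 => B l I)) => // i _ /(_ k); exact.
have h I : layer_avg A (N I) F I ^+ 2 <= 32 * B (l I) I ^+ 2 +
    2 * \sum_(n < q) n.+1%:R * (layer_avg A n.+2 F I - layer_avg A n F I) ^+ 2.
  have NI : (N I <= q)%N by rewrite -ltnS.
  apply: (@tauberian R (fun n => layer_avg A n F I) (B (l I) I) (N I) q) => //.
    by move=> n; exact: layer_avg_ge0.
  apply: le_trans (sumB I NI) _.
  apply: (@le_trans _ _ (\sum_(k < (N I).*2.+1) B (l I) I)); last first.
    by rewrite sumr_const card_ord [X in _ <= X]mulr_natl.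
  apply: ler_sum => k _.
  have kq : (k < q.*2.+1)%N by apply: leq_trans (ltn_ord k) _; rewrite ltnS leq_double.
  exact: (Bl I (Ordinal kq)).
apply: (@le_trans _ _ (\sum_I (32 * B (l I) I ^+ 2 +
    2 * \sum_(n < q) n.+1%:R * (layer_avg A n.+2 F I - layer_avg A n F I) ^+ 2))).
  by apply: ler_sum => I _; exact: h.
rewrite big_split /= -!mulr_sumr.
have := B_selector l; have := square_function F qA.
have -> : \sum_I \sum_(n < q) n.+1%:R * (layer_avg A n.+2 F I - layer_avg A n F I) ^+ 2 =
  \sum_(n < q) n.+1%:R * \sum_I (layer_avg A n.+2 F I - layer_avg A n F I) ^+ 2.
  by rewrite exchange_big; apply: eq_bigr => n _; rewrite mulr_sumr.
by lra.
Qed.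
End cube_maximal.

(** * Several disjoint blocks of coordinates *)

Section iterated.
Variables (R : realFieldType) (T : finType).
Implicit Types (A H I J : {set T}) (F G : {set T} -> R).

Lemma le_layer_avg A n F G I : (forall J, F J <= G J) -> layer_avg A n F I <= layer_avg A n G I.
Proof.
by move=> FG; rewrite /layer_avg ler_wpM2l ?invr_ge0 ?ler0n//; apply: ler_sum.
Qed.

Definition layer_max A q F I : R := \big[Num.max/0]_(n < q.+1) layer_avg A n F I.

Lemma layer_max_ge0 A q F I : 0 <= layer_max A q F I.
Proof. by apply: bigmax_ge_id. Qed.

Lemma layer_avg_le_max A q n F I : (n <= q)%N -> layer_avg A n F I <= layer_max A q F I.
Proof.
rewrite -ltnS => nq.
exact: (le_bigmax _ (fun n : 'I_q.+1 => layer_avg A n F I) (Ordinal nq)).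
Qed.

Lemma layer_max_attained A q F I : (forall I, 0 <= F I) ->
  {n : 'I_q.+1 | layer_max A q F I = layer_avg A n F I}.
Proof.
move=> F0; pose n := [arg max_(n > (ord0 : 'I_q.+1)) layer_avg A n F I]%O.
exists n; apply/eqP; rewrite eq_le layer_avg_le_max ?andbT; last by rewrite -ltnS.
apply/bigmax_leP; split; first exact: layer_avg_ge0.
move=> i _; rewrite /n.
by case: (@Order.TotalTheory.arg_maxP _ _ _ (ord0 : 'I_q.+1) xpredT
  (fun n : 'I_q.+1 => layer_avg A n F I)) => // j _ /(_ i); exact.
Qed.

Lemma layer_max_l2 A q F : (32 * q.+1 <= #|A|)%N -> (forall I, 0 <= F I) ->
  \sum_I (layer_max A q F I) ^+ 2 <= 328 * \sum_I F I ^+ 2.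
Proof.
move=> qA F0.
pose N I := sval (layer_max_attained A q I F0).
rewrite (eq_bigr (fun I => layer_avg A (N I) F I ^+ 2)); first exact: cube_maximal.
by move=> I _; rewrite /N; case: layer_max_attained => n /= ->.
Qed.

Definition iter_max q (s : seq {set T}) F := foldr (fun A G => layer_max A q G) F s.

Definition iter_avg (s : seq ({set T} * nat)) F :=
  foldr (fun p G => layer_avg p.1 p.2 G) F s.

Lemma iter_max_ge0 q s F I : (forall I, 0 <= F I) -> 0 <= iter_max q s F I.
Proof. by case: s => [|A s] F0 //=; exact: layer_max_ge0. Qed.

(** Each of the operators is bounded on l^2 on the whole cube, also when it only
    moves the coordinates of its own block. *)
Lemma iter_max_l2 q s F : all (fun A : {set T} => 32 * q.+1 <= #|A|)%N s ->
  (forall I, 0 <= F I) ->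
  \sum_I (iter_max q s F I) ^+ 2 <= 328 ^+ size s * \sum_I F I ^+ 2.
Proof.
move=> + F0; elim: s => [_|A s IH /= /andP[qA /IH h]]; first by rewrite expr0 mul1r.
apply: le_trans (layer_max_l2 qA _) _; first by move=> I; exact: iter_max_ge0.
by rewrite exprS -mulrA ler_pM2l.
Qed.

Lemma iter_max_shift q s F I J :
  iter_max q s (fun H => F (symdiff I H)) J = iter_max q s F (symdiff I J).
Proof.
elim: s J => [//|A s IH] J /=; rewrite /layer_max; apply: eq_bigr => n _.
by rewrite /layer_avg; congr (_ * _); apply: eq_bigr => H _; rewrite IH symdiffA.
Qed.

Lemma iter_avg_le_max q (s : seq ({set T} * nat)) F I : all (fun p => p.2 <= q)%N s ->
  iter_avg s F I <= iter_max q (map fst s) F I.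
Proof.
elim: s I => [//|[A n] s IH] I /= /andP[nq sq].
by apply: le_trans (layer_avg_le_max _ _ _ nq); apply: le_layer_avg => J; exact: IH.
Qed.

Lemma iter_avg_sum (X : finType) s (F : X -> {set T} -> R) I :
  iter_avg s (fun H => \sum_x F x H) I = \sum_x iter_avg s (F x) I.
Proof.
elim: s I => [//|[A n] s IH] I /=; rewrite {1}/layer_avg -mulr_sumr; congr (_ * _).
by rewrite exchange_big /=; apply: eq_bigr => H _; exact: IH.
Qed.

(** The translations that occur when [iter_avg s] is unfolded. *)
Fixpoint layers (s : seq ({set T} * nat)) H : Prop :=
  if s is (A, n) :: s' then
    exists H1 H2, [/\ H1 \in layer A n, layers s' H2 & H = symdiff H1 H2]
  else H = set0.

(** All values of F that enter the composition equal v. *)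
Lemma iter_avg_const (s : seq ({set T} * nat)) F (v : R) I :
  all (fun p : {set T} * nat => p.2 <= #|p.1|)%N s ->
  (forall H, layers s H -> F (symdiff I H) = v) -> iter_avg s F I = v.
Proof.
elim: s I => [|[A n] s IH] I /=; first by move=> _ /(_ set0 erefl); rewrite symdiff0.
move=> /andP[nA sA] h; rewrite /layer_avg (eq_bigr (fun=> v)) => [|H HA].
  rewrite sumr_const card_layer -[v *+ _]mulr_natl mulKf//.
  by rewrite pnatr_eq0 -lt0n bin_gt0.
by apply: IH => // H' sH'; rewrite -symdiffA; apply: h; exists H, H'.
Qed.

(** For disjoint blocks the symmetric differences are disjoint unions, so the
    trace on each block is the member of its layer. *)
Lemma layers_disjoint (I : eqType) (A : I -> {set T}) (n : I -> nat) (s : seq I) H :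
  (forall i j x, x \in A i -> x \in A j -> i = j) -> uniq s ->
  layers [seq (A i, n i) | i <- s] H ->
  (forall i, i \in s -> #|H :&: A i| = n i) /\
  (forall x, x \in H -> exists2 i, i \in s & x \in A i).
Proof.
move=> dA; elim: s H => [|i s IH] H /=; first by move=> _ ->; split=> // x; rewrite inE.
move=> /andP[is' us] [H1 [H2 [H1A /(IH _ us)[cH2 sH2] ->]]].
move: H1A; rewrite inE => /andP[H1A /eqP cH1].
have d1 x j : x \in H1 -> x \in A j -> i = j.
  by move=> /(subsetP H1A) xi; exact: dA.
have d2 x : x \in H2 -> x \notin A i.
  by move=> /sH2[j js xj]; apply/negP => xi; rewrite -(dA _ _ _ xj xi) js in is'.
split=> [j|x].
  rewrite inE => /predU1P[->|js].
    rewrite -cH1; apply: eq_card => x; rewrite inE in_symdiff.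
    case x1: (x \in H1); case x2: (x \in H2) => //=.
    - by have := d2 _ x2; rewrite (subsetP H1A).
    - exact: (subsetP H1A).
    - exact/negbTE/d2.
  rewrite -(cH2 j js); apply: eq_card => x; rewrite !inE.
  case xj: (x \in A j); rewrite ?andbF// !andbT.
  case x1: (x \in H1) => /=; last by rewrite andbF.
  by rewrite (d1 _ _ x1 xj) js in is'.
rewrite in_symdiff; have [x1 _|x1 /= x2] := boolP (x \in H1).
  by exists i; rewrite ?inE ?eqxx// (subsetP H1A).
by have [j js xj] := sH2 x x2; exists j; rewrite // inE js orbT.
Qed.

End iterated.

(** * Signed permutations and stamps in the lattice *)

Section signed_permutations.
Variable d : nat.
Implicit Types (s H I : {set 'I_d}) (p : {perm 'I_d}) (y : lattice d).

Definition entry y (j : 'I_d) : int := (y : 'rV[int]_d) ord0 j.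

(** The sign is attached to the source coordinate [p j], so that sign changes of a
    stamp do not interact with the permutation, see [signed_perm_stamp]. *)
Definition signed_perm s p y : lattice d :=
  \row_j ((-1) ^+ (p j \in s) * entry y (p j)).

(** The modulus K numbers the blocks, so the nonzero entries range over 1, ..., K. *)
Definition stamp K H : lattice d :=
  \row_j (if j \in H then (j %% K).+1%:Z else 0).

Definition block K k : {set 'I_d} := [set j : 'I_d | (j %% K)%N == k].

Lemma entry_inj y y' : entry y =1 entry y' -> y = y'.
Proof. by move=> e; apply/rowP => j; exact: e. Qed.

Lemma entry_signed_perm s p y j :
  entry (signed_perm s p y) j = (-1) ^+ (p j \in s) * entry y (p j).
Proof. by rewrite /entry mxE. Qed.

Lemma entry_stamp K H j : entry (stamp K H) j = if j \in H then (j %% K).+1%:Z else 0.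
Proof. by rewrite /entry mxE. Qed.

Lemma entryD y y' j : entry (y + y') j = entry y j + entry y' j.
Proof. by rewrite /entry mxE. Qed.

Lemma signed_perm_comp s p s0 p0 y :
  signed_perm s p (signed_perm s0 p0 y) = signed_perm (symdiff (p0 @: s) s0) (p * p0)%g y.
Proof.
apply: entry_inj => j; rewrite !entry_signed_perm mulrA permM; congr (_ * _).
by rewrite in_symdiff signr_addb (mem_imset _ _ (@perm_inj _ p0)).
Qed.

(** The identity behind the transference.  Along I :&: H the stamp on the left
    vanishes, and the two terms on the right cancel because the second one has
    the opposite sign on I. *)
Lemma signed_perm_stamp K s p I H :
  signed_perm s p (stamp K (symdiff I H)) =
  signed_perm s p (stamp K I) + signed_perm (symdiff s I) p (stamp K H).
Proof.
apply: entry_inj => j; rewrite entryD !entry_signed_perm !entry_stamp !in_symdiff signr_addb.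
by case: (p j \in s); case: (p j \in I); case: (p j \in H) => /=; ring.
Qed.

Lemma sum_signed_perm (V : nmodType) (phi : lattice d -> V) s0 p0 y :
  \sum_s \sum_p phi (signed_perm s p (signed_perm s0 p0 y)) =
  \sum_s \sum_p phi (signed_perm s p y).
Proof.
have injs : injective (fun s => symdiff (p0 @: s) s0).
  move=> s s' /(inv_inj (@symdiffK _ s0)); exact: (imset_inj (@perm_inj _ p0)).
rewrite [RHS](reindex_inj injs) /=; apply: eq_bigr => s _.
rewrite [RHS](reindex_inj (mulIg p0)) /=; apply: eq_bigr => p _.
by rewrite signed_perm_comp.
Qed.

(** The numbers i K + k with i < d %/ K lie in the block. *)
Lemma card_block K k : (k < K)%N -> (d %/ K <= #|block K k|)%N.
Proof.
move=> kK; have K0 : (0 < K)%N by apply: leq_ltn_trans kK.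
have bd (i : 'I_(d %/ K)) : (i * K + k < d)%N.
  apply: (@leq_trans (i.+1 * K)); first by rewrite mulSn addnC ltn_add2r.
  by apply: leq_trans (leq_trunc_div d K); rewrite leq_mul2r ltn_ord orbT.
pose f i : 'I_d := Ordinal (bd i).
have fi : injective f.
  move=> i i' /(congr1 val) /= /eqP; rewrite eqn_add2r eqn_pmul2r// => /eqP e.
  exact: val_inj.
rewrite -[X in (X <= _)%N]card_ord -(card_imset _ fi); apply: subset_leq_card.
by apply/fintype.subsetP => _ /imsetP[i _ ->]; rewrite inE /= modnMDl modn_small.
Qed.

Lemma block_inj K i k (x : 'I_d) : x \in block K i -> x \in block K k -> i = k.
Proof. by rewrite !inE => /eqP <- /eqP. Qed.

Lemma sum_fibers (T : finType) (f : T -> nat) K : (forall x, (f x <= K)%N) ->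
  (\sum_(v < K.+1) #|[pred x | f x == v]| = #|T|)%N.
Proof.
move=> fK; rewrite -[RHS]sum1_card (partition_big (fun x => inord (f x) : 'I_K.+1) xpredT)//=.
apply: eq_bigr => v _; rewrite -sum1_card; apply: eq_bigl => x.
by rewrite inE -val_eqE /= inordK// ltnS.
Qed.

(** The absolute values of the entries of y and of the stamp have the same fibre
    cardinalities: for nonzero values by hypothesis, and for the value 0 because
    the cardinalities add up to d. *)
Lemma stamp_orbit K H y : (0 < K)%N -> (forall j, (absz (entry y j) <= K)%N) ->
  (forall k, (k < K)%N ->
     #|H :&: block K k| = #|[set j | absz (entry y j) == k.+1]|) ->
  exists s0 p0, y = signed_perm s0 p0 (stamp K H).
Proof.
move=> K0 yK cnt; pose f j := absz (entry y j); pose g j := absz (entry (stamp K H) j).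
have gE j : g j = if j \in H then (j %% K).+1 else 0%N.
  by rewrite /g entry_stamp; case: ifP.
have gK j : (g j <= K)%N by rewrite gE; case: ifP => // _; rewrite ltn_pmod.
have cpos v : #|[pred j | f j == v.+1]| = #|[pred j | g j == v.+1]|.
  have [vK|vK] := ltnP v K; last first.
    rewrite !eq_card0// => j; rewrite !inE; apply/negbTE/eqP => e.
      by have := gK j; rewrite e ltnNge vK.
    by have := yK j; rewrite -/(f j) e ltnNge vK.
  have -> : #|[pred j | f j == v.+1]| = #|[set j | absz (entry y j) == v.+1]|.
    by apply: eq_card => j; rewrite !inE.
  rewrite -cnt//; apply: eq_card => j; rewrite !inE gE.
  by case: (j \in H); rewrite /= ?eqSS.
(* Both families of fibres over 0, ..., K have total cardinality d. *)
have c0 : #|[pred j | f j == 0%N]| = #|[pred j | g j == 0%N]|.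
  have := sum_fibers gK; rewrite -(sum_fibers yK) !big_ord_recl /= -/f.
  rewrite (eq_bigr (fun i : 'I_K => #|[pred j | f j == i.+1]|)) => [|i _]; last first.
    by rewrite cpos.
  by move=> /eqP; rewrite eqn_add2r => /eqP.
have [p pE] : exists p : {perm 'I_d}, forall j, f j = g (p j).
  by apply: fiber_perm => -[|v].
exists [set i | entry y ((p^-1)%g i) < 0], p; apply: entry_inj => j.
rewrite entry_signed_perm inE permK.
have -> : entry (stamp K H) (p j) = (g (p j))%:Z.
  by rewrite gE entry_stamp; case: ifP.
rewrite -pE /f; case: ltP => h; rewrite ?expr1 ?expr0 ?mul1r ?mulN1r; lia.
Qed.

End signed_permutations.

(** * Counting points on spheres *)

Lemma big_seq_bij (V : nmodType) (T : eqType) (r1 r2 : seq T) (P1 P2 : pred T)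
    (f g : T -> T) (F : T -> V) :
  uniq r1 -> uniq r2 -> cancel f g -> cancel g f ->
  (forall x, (f x \in r2) && P2 (f x) = (x \in r1) && P1 x) ->
  \sum_(y <- r2 | P2 y) F y = \sum_(x <- r1 | P1 x) F (f x).
Proof.
move=> u1 u2 fg gf e; rewrite -big_filter -[RHS]big_filter -(big_map f xpredT F).
apply: perm_big; apply: uniq_perm; rewrite ?filter_uniq//.
  by rewrite map_inj_uniq ?filter_uniq//; exact: can_inj fg.
move=> y; rewrite -[y]gf mem_map; last exact: can_inj fg.
by rewrite !mem_filter andbC e andbC.
Qed.

Section spheres.
Variable d : nat.
Implicit Types (y z : lattice d) (j : 'I_d).

Definition sqnorm y : int := \sum_(j < d) entry y j ^+ 2.

Definition sphere_seq n : seq (lattice d) := fset_set (@sphere d n).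

Lemma mem_sphere_seq y n : (y \in sphere_seq n) = (sqnorm y == n%:Z).
Proof.
rewrite /sphere_seq in_fset_set; last exact: finite_sphere.
by apply/idP/eqP; rewrite in_setE.
Qed.

Lemma sphere_seq_uniq n : uniq (sphere_seq n).
Proof. exact: fset_uniq. Qed.

Lemma entry_le_sqnorm y j : (absz (entry y j) <= absz (sqnorm y))%N.
Proof.
have h : entry y j ^+ 2 <= sqnorm y.
  by rewrite /sqnorm (bigD1 j)//= lerDl; apply: sumr_ge0 => i _; exact: sqr_ge0.
have : (absz (entry y j) <= absz (entry y j ^+ 2))%N.
  by rewrite abszX; case: (absz _) => // k; rewrite expnS leq_pmulr ?expn_gt0.
by move=> /leq_trans; apply; have := sqr_ge0 (entry y j); lia.
Qed.

Definition axis j (c : int) : lattice d := \row_i (if i == j then c else 0).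

Lemma entry_axis j c i : entry (axis j c) i = if i == j then c else 0.
Proof. by rewrite /entry mxE. Qed.

Lemma sqnorm_axis y j c : entry y j = 0 -> sqnorm (y + axis j c) = sqnorm y + c ^+ 2.
Proof.
move=> y0; rewrite /sqnorm (bigD1 j)//= [in RHS](bigD1 j)//= entryD entry_axis eqxx y0.
rewrite add0r expr0n add0r addrC; congr (_ + _); apply: eq_bigr => i /negbTE ij.
by rewrite entryD entry_axis ij addr0.
Qed.

(** Subtracting c from the j-th entry is a bijection onto the points with j-th
    entry 0 on the smaller sphere. *)
Lemma count_axis m n j c : (n%:Z = m%:Z + c ^+ 2) ->
  count (fun y => entry y j == c) (sphere_seq n) =
  count (fun y => entry y j == 0) (sphere_seq m).
Proof.
move=> e; rewrite -!sum1_count.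
apply: (@big_seq_bij nat _ _ _ _ _
  (fun y => y + axis j c) (fun y => y - axis j c) (fun=> 1%N)).
- exact: sphere_seq_uniq.
- exact: sphere_seq_uniq.
- exact: addrK.
- exact: subrK.
move=> y; rewrite !mem_sphere_seq entryD entry_axis eqxx.
have -> : (entry y j + c == c) = (entry y j == 0) by rewrite -subr_eq0 addrK.
case: (entry y j =P 0) => [y0|]; last by rewrite !andbF.
by rewrite !andbT sqnorm_axis// e (inj_eq (addIr _)).
Qed.

Lemma sum_count_entry (P : int -> bool) (s : seq (lattice d)) :
  (\sum_(j < d) count (fun y => P (entry y j)) s =
   \sum_(y <- s) #|[pred j | P (entry y j)]|)%N.
Proof.
transitivity (\sum_(j < d) \sum_(y <- s) (if P (entry y j) then 1 else 0))%N.
  by apply: eq_bigr => j _; rewrite -big_mkcond sum1_count.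
rewrite exchange_big /=; apply: eq_bigr => y _.
by rewrite -big_mkcond sum1_card.
Qed.

Lemma nonzero_le_sqnorm y : (#|[pred j | entry y j != 0]| <= absz (sqnorm y))%N.
Proof.
have : (#|[pred j | entry y j != 0]|%:Z <= sqnorm y).
  rewrite -sum1_card -natz natr_sum /sqnorm big_mkcond; apply: ler_sum => j _.
  by rewrite inE; case: eqP => [->|/eqP y0]; rewrite ?expr0n//= -gtz0_ge1 exprn_even_gt0.
by move: (#|_|) (sqnorm y) => a b; lia.
Qed.

(** Count the pairs (y, z) with z obtained from y by changing an entry 0 into 1 or
    -1.  A point y with square norm m has at least d - m zero entries, and a
    point z with square norm m+1 has at most m+1 entries 1 or -1. *)
Lemma size_sphere_seq_step m :
  (2 * (d - m) * size (sphere_seq m) <= m.+1 * size (sphere_seq m.+1))%N.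
Proof.
have h1 : ((d - m) * size (sphere_seq m) <=
    \sum_(j < d) count (fun y => (entry y j) == 0%R) (sphere_seq m))%N.
  rewrite (sum_count_entry (fun c => c == 0)) mulnC -sum1_size big_distrl /=.
  rewrite !big_seq; apply: leq_sum => y; rewrite mem_sphere_seq => /eqP ym.
  have := nonzero_le_sqnorm y; rewrite ym /= mul1n => h.
  have := cardC [pred j | entry y j == 0]; rewrite card_ord.
  rewrite -[#|[predC _]|]/(#|[pred j | entry y j != 0]|).
  by move: h; move: (#|_|) (#|_|) => a b; lia.
have h2 c : c ^+ 2 = 1 -> (\sum_(j < d) count (fun y => entry y j == c) (sphere_seq m.+1)
   = \sum_(j < d) count (fun y => entry y j == 0%R) (sphere_seq m))%N.
  by move=> c1; apply: eq_bigr => j _; apply: count_axis; rewrite c1; lia.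
have h3 : (\sum_(j < d) count (fun y => entry y j == 1%R) (sphere_seq m.+1) +
   \sum_(j < d) count (fun y => entry y j == (-1)%R) (sphere_seq m.+1)
     <= m.+1 * size (sphere_seq m.+1))%N.
  rewrite !(sum_count_entry (fun c => c == _)) -big_split /= mulnC -sum1_size big_distrl /=.
  rewrite !big_seq; apply: leq_sum => y; rewrite mem_sphere_seq => /eqP ym.
  rewrite mul1n; have := nonzero_le_sqnorm y; rewrite ym /=; apply: leq_trans.
  rewrite -cardUI addnC eq_card0 ?add0n; last first.
    by move=> j; rewrite !inE; case: eqP => // ->.
  by apply: subset_leq_card; apply/fintype.subsetP => j; rewrite !inE => /orP[]/eqP ->.
rewrite !h2// in h3; apply: leq_trans h3.
by rewrite mul2n -muln2 mulnAC muln2 -addnn; apply: leq_add.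
Qed.

(** The points with an entry too large for a stamp. *)
Definition wide K y := [exists j, (K < absz (entry y j))%N].

Section decay.
Variables (R : realFieldType) (rho : R) (n0 : nat).
Hypotheses (rho0 : 0 <= rho) (rho1 : rho <= 1).
Hypotheses (d0 : (0 < d)%N) (n0d : (2 * n0 <= d)%N) (n0rho : n0%:R <= rho * d%:R).

(** Since m < n0 <= d/2, one step multiplies the number of points by at least
    2 (d - m) / (m + 1) >= d / n0 >= 1 / rho. *)
Lemma size_sphere_seq_decay n k : (n <= n0)%N -> (k <= n)%N ->
  (size (sphere_seq (n - k)))%:R <= rho ^+ k * (size (sphere_seq n))%:R.
Proof.
move=> nn0; elim: k => [|k IH] kn; first by rewrite subn0 expr0 mul1r.
apply: le_trans (_ : rho * (size (sphere_seq (n - k)))%:R <= _); last first.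
  by rewrite exprS -mulrA ler_wpM2l// IH// ltnW.
have e : (n - k = (n - k.+1).+1)%N by lia.
rewrite e; set m := (n - k.+1)%N in e *.
have dR : 0 < (d%:R : R) by rewrite ltr0n.
rewrite -(ler_pM2l dR) mulrA.
apply: (@le_trans _ _ (n0%:R * (size (sphere_seq m.+1))%:R)); last first.
  by rewrite ler_wpM2r// mulrC.
rewrite -!natrM ler_nat.
apply: (@leq_trans (2 * (d - m) * size (sphere_seq m))).
  by rewrite leq_mul2r; apply/orP; right; lia.
by apply: leq_trans (size_sphere_seq_step m) _; rewrite leq_mul2r; apply/orP; right; lia.
Qed.

(** There are d positions and at most 2 (n + 1) values for a large entry; removing
    an entry c lowers the square norm by c^2 >= (K+1)^2. *)
Lemma count_wide K n : (n <= n0)%N ->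
  (count (wide K) (sphere_seq n))%:R <=
    (d * n.+1 * 2)%:R * rho ^+ (K.+1 ^ 2) * (size (sphere_seq n))%:R.
Proof.
move=> nn0.
have cj j c : (K < absz c)%N ->
   (count (fun y => entry y j == c) (sphere_seq n))%:R
     <= rho ^+ (K.+1 ^ 2) * (size (sphere_seq n))%:R.
  move=> Kc; have [cn|cn] := leqP (absz c ^ 2) n; last first.
    rewrite (eq_in_count (a2 := pred0)) ?count_pred0 ?mulr_ge0 ?exprn_ge0// => y.
    rewrite mem_sphere_seq => /eqP yn; apply/negbTE/eqP => yc; move: cn.
    rewrite ltnNge => /negP; apply.
    have : entry y j ^+ 2 <= sqnorm y.
      by rewrite /sqnorm (bigD1 j)//= lerDl; apply: sumr_ge0 => i _; exact: sqr_ge0.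
    by rewrite yn yc -abszX; have := sqr_ge0 c; lia.
  rewrite (@count_axis (n - absz c ^ 2)); last first.
    by rewrite -[c ^+ 2]gez0_abs ?sqr_ge0// abszX; lia.
  apply: (@le_trans _ _ (size (sphere_seq (n - absz c ^ 2)))%:R).
    by rewrite ler_nat count_size.
  apply: le_trans (size_sphere_seq_decay nn0 cn) _; rewrite ler_wpM2r//.
  by rewrite ler_wiXn2l// leq_sqr.
have wj j : (count (fun y => (K < absz (entry y j))%N) (sphere_seq n) <=
  \sum_(k < n.+1 | (K < k)%N) (count (fun y => entry y j == k%:Z) (sphere_seq n) +
      count (fun y => entry y j == (- k%:Z)%R) (sphere_seq n)))%N.
  rewrite -sum1_count big_split /=.
  under [X in (_ <= X + _)%N]eq_bigr do rewrite -sum1_count big_mkcond.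
  under [X in (_ <= _ + X)%N]eq_bigr do rewrite -sum1_count big_mkcond.
  rewrite exchange_big /= [X in (_ <= _ + X)%N]exchange_big /= -big_split /=.
  rewrite big_mkcond big_seq [X in (_ <= X)%N]big_seq; apply: leq_sum => y.
  rewrite mem_sphere_seq => /eqP yn; case: ifP => // Ky.
  have yb : (absz (entry y j) < n.+1)%N by have := entry_le_sqnorm y j; rewrite yn ltnS.
  rewrite (bigD1 (Ordinal yb))//= [X in (_ <= _ + X)%N](bigD1 (Ordinal yb))//=.
  rewrite addnACA; apply: leq_trans (leq_addr _ _).
  by case: (entry y j) => k /=; rewrite ?eqxx// NegzE abszN eqxx addnC.
have w : (count (wide K) (sphere_seq n) <=
    \sum_(j < d) count (fun y => (K < absz (entry y j))%N) (sphere_seq n))%N.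
  rewrite (sum_count_entry (fun c => K < absz c)%N) -sum1_count big_mkcond.
  apply: leq_sum => y _.
  by case: ifP => // /existsP[j yj]; apply/card_gt0P; exists j.
set r := rho ^+ (K.+1 ^ 2) * _ in cj; have r0 : 0 <= r by rewrite mulr_ge0 ?exprn_ge0.
apply: (@le_trans _ _ (\sum_(j < d) \sum_(k < n.+1 | (K < k)%N) (r + r))).
  apply: (@le_trans _ _
    ((\sum_(j < d) count (fun y => (K < absz (entry y j))%N) (sphere_seq n))%N%:R)).
    by rewrite ler_nat.
  rewrite natr_sum; apply: ler_sum => j _.
  apply: (@le_trans _ _ ((\sum_(k < n.+1 | (K < k)%N)
      (count (fun y => entry y j == k%:Z) (sphere_seq n) +
       count (fun y => entry y j == (- k%:Z)%R) (sphere_seq n)))%N%:R)).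
    by rewrite ler_nat.
  rewrite natr_sum; apply: ler_sum => k Kk; rewrite natrD.
  by apply: lerD; apply: cj; rewrite ?abszN.
apply: (@le_trans _ _ (\sum_(j < d) \sum_(k < n.+1) (r + r))).
  apply: ler_sum => j _; rewrite big_mkcond; apply: ler_sum => k _.
  by case: ifP => // _; rewrite addr_ge0.
rewrite !sumr_const !card_ord -mulr2n -!mulrnA -[r *+ _]mulr_natl -mulrA -/r.
by have -> : (2 * (n.+1 * d) = d * n.+1 * 2)%N by lia.
Qed.
End decay.
End spheres.

(** * Pointwise domination of spherical means *)

Section signed_perm_invariance.
Variable d : nat.
Implicit Types (s : {set 'I_d}) (p : {perm 'I_d}) (y : lattice d).

Lemma signed_perm1 y : signed_perm set0 1%g y = y.
Proof. by apply: entry_inj => j; rewrite entry_signed_perm inE perm1 mul1r. Qed.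

Lemma signed_permK s p : cancel (signed_perm s p) (signed_perm (p^-1%g @: s) p^-1%g).
Proof.
move=> y; rewrite signed_perm_comp mulVg -imset_comp_perm mulVg.
by rewrite (eq_imset _ (@perm1 _)) imset_id symdiffxx signed_perm1.
Qed.

Lemma signed_permVK s p : cancel (signed_perm (p^-1%g @: s) p^-1%g) (signed_perm s p).
Proof. by move=> y; rewrite signed_perm_comp mulgV symdiffxx signed_perm1. Qed.

Lemma sqnorm_signed_perm s p y : sqnorm (signed_perm s p y) = sqnorm y.
Proof.
rewrite /sqnorm [RHS](reindex_inj (@perm_inj _ p)) /=; apply: eq_bigr => j _.
by rewrite entry_signed_perm exprMn sqrr_sign mul1r.
Qed.

Lemma wide_signed_perm K s p y : wide K (signed_perm s p y) = wide K y.
Proof.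
have e j : absz (entry (signed_perm s p y) j) = absz (entry y (p j)).
  by rewrite entry_signed_perm abszM abszX /= exp1n mul1n.
apply/existsP/existsP => -[j]; first by rewrite e; exists (p j).
by move=> h; exists (p^-1%g j); rewrite e permKV.
Qed.

Lemma sum_narrow_signed_perm (V : nmodType) K n s p (F : lattice d -> V) :
  \sum_(y <- sphere_seq d n | ~~ wide K y) F (signed_perm s p y) =
  \sum_(y <- sphere_seq d n | ~~ wide K y) F y.
Proof.
apply/esym; apply: big_seq_bij (signed_permK s p) (signed_permVK s p) _;
  try exact: sphere_seq_uniq.
by move=> y; rewrite !mem_sphere_seq sqnorm_signed_perm wide_signed_perm.
Qed.
End signed_perm_invariance.

Section domination.
Variables (R : realFieldType) (d K N : nat).
Hypotheses (K0 : (0 < K)%N) (dK : (32 * N.+1 <= d %/ K)%N).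
Implicit Types (y : lattice d) (phi : lattice d -> R).

Definition blocks : seq {set 'I_d} := [seq block d K k | k <- iota 0 K].

(** The iterated maximal function over the blocks, on the copy of the cube that
    the signed permutation (s, p) of stamps draws in the lattice. *)
Definition stamp_max phi s p : R :=
  iter_max N blocks (fun H => phi (signed_perm s p (stamp K H))) set0.

Lemma blocks_large : all (fun A : {set 'I_d} => 32 * N.+1 <= #|A|)%N blocks.
Proof.
apply/allP => A /mapP[k]; rewrite mem_iota add0n => /andP[_ kK] ->.
exact: leq_trans dK (card_block d kK).
Qed.

(** Averaged over signed permutations, the value of [phi] at y equals its value at
    any stamp of the same type, hence also the composition of layer averages,
    one for each block, evaluated on the cube of stamps. *)
Lemma narrow_point_le phi y : ~~ wide K y -> (absz (sqnorm y) <= N)%N ->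
  \sum_s \sum_p phi (signed_perm s p y) <= \sum_s \sum_p stamp_max phi s p.
Proof.
move=> yK yN; pose nk k := #|[set j | absz (entry y j) == k.+1]|.
have nkN k : (nk k <= N)%N.
  apply: leq_trans yN; apply: leq_trans (nonzero_le_sqnorm y).
  apply: subset_leq_card; apply/fintype.subsetP => j; rewrite !inE.
  by move=> /eqP e; apply/eqP => y0; rewrite y0 in e.
pose ps := [seq (block d K k, nk k) | k <- iota 0 K].
pose Phi H := \sum_s \sum_p phi (signed_perm s p (stamp K H)).
have <- : iter_avg ps Phi set0 = \sum_s \sum_p phi (signed_perm s p y).
  apply: iter_avg_const => [|H].
    apply/allP => q /mapP[k]; rewrite mem_iota add0n => /andP[_ kK] -> /=.
    apply: leq_trans (nkN k) _; apply: leq_trans (card_block d kK).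
    by apply: leq_trans dK; lia.
  move=> /(layers_disjoint (@block_inj d K) (iota_uniq 0 K))[cH _].
  have yK' j : (absz (entry y j) <= K)%N.
    by rewrite leqNgt; apply: contra yK => h; apply/existsP; exists j.
  have [s0 [p0 ->]] : exists s0 p0, y = signed_perm s0 p0 (stamp K H).
    apply: stamp_orbit => // k kK; apply: cH.
    by rewrite mem_iota add0n.
  by rewrite sum_signed_perm sym0diff.
rewrite /Phi iter_avg_sum; apply: ler_sum => s _.
rewrite iter_avg_sum; apply: ler_sum => p _.
rewrite /stamp_max; have -> : blocks = map fst ps by rewrite -map_comp; apply: eq_map.
apply: iter_avg_le_max; by apply/allP => q0 /mapP[k _ ->]; exact: nkN.
Qed.

Definition signed_perm_count : R := #|{set 'I_d}|%:R * #|{perm 'I_d}|%:R.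

Lemma signed_perm_count_gt0 : 0 < signed_perm_count.
Proof.
by rewrite mulr_gt0// ltr0n; apply/card_gt0P; [exists set0|exists 1%g].
Qed.

Lemma sum_signed_perm_cst (v : R) :
  \sum_(s : {set 'I_d}) \sum_(p : {perm 'I_d}) v = signed_perm_count * v.
Proof.
rewrite !sumr_const -mulrnA -[v *+ _]mulr_natl natrM.
by rewrite /signed_perm_count [#|{perm _}|%:R * _]mulrC.
Qed.

(** Signed permutations preserve the narrow points of a sphere, so the average
    over the sphere may be averaged over signed permutations first. *)
Lemma narrow_sum_le phi n : (forall y, 0 <= phi y) -> (n <= N)%N ->
  signed_perm_count * \sum_(y <- sphere_seq d n | ~~ wide K y) phi y <=
  (size (sphere_seq d n))%:R * \sum_s \sum_p stamp_max phi s p.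
Proof.
move=> phi0 nN; rewrite -sum_signed_perm_cst.
rewrite (eq_bigr (fun s =>
  \sum_p \sum_(y <- sphere_seq d n | ~~ wide K y) phi (signed_perm s p y))); last first.
  by move=> s _; apply: eq_bigr => p _; rewrite sum_narrow_signed_perm.
under eq_bigr do rewrite exchange_big /=; rewrite exchange_big /=.
have M0 : 0 <= \sum_s \sum_p stamp_max phi s p.
  by apply: sumr_ge0 => s _; apply: sumr_ge0 => p _; apply: iter_max_ge0.
rewrite -sum1_size natr_sum mulr_suml.
rewrite big_seq_cond [X in _ <= X]big_seq_cond big_mkcond [X in _ <= X]big_mkcond /=.
apply: ler_sum => y _; rewrite andbT mul1r; case: ifP => [/andP[]|_]; last by case: ifP.
rewrite mem_sphere_seq => /eqP yn yK; rewrite yn eqxx.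
by apply: narrow_point_le; rewrite ?yn.
Qed.

(** The spherical mean at x of a function h is obtained for
    [phi := fun y => h (x - y)]. *)
Definition sphere_mean n phi : R :=
  (size (sphere_seq d n))%:R^-1 * \sum_(y <- sphere_seq d n) phi y.

Definition stamp_majorant phi : R :=
  signed_perm_count^-1 * \sum_s \sum_p stamp_max phi s p ^+ 2.

Definition wide_fraction n : R :=
  (count (@wide d K) (sphere_seq d n))%:R / (size (sphere_seq d n))%:R.

Definition wide_majorant n phi : R :=
  wide_fraction n *
  ((size (sphere_seq d n))%:R^-1 * \sum_(y <- sphere_seq d n | wide K y) phi y ^+ 2).

Lemma sq_sum_seq (r : seq (lattice d)) (P : pred (lattice d)) (F : lattice d -> R) :
  (\sum_(y <- r | P y) F y) ^+ 2 <= (count P r)%:R * \sum_(y <- r | P y) F y ^+ 2.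
Proof.
rewrite -sum1_count natr_sum ![\sum_(_ <- r | _) _]big_tnth.
exact: sq_sum_le.
Qed.

(** The narrow and the wide parts of the sphere are treated separately; the
    Cauchy-Schwarz inequality produces the two majorants. *)
Lemma sphere_mean_sq_le phi n : (forall y, 0 <= phi y) -> (n <= N)%N ->
  sphere_mean n phi ^+ 2 <= 2 * stamp_majorant phi + 2 * wide_majorant n phi.
Proof.
move=> phi0 nN; rewrite /sphere_mean (bigID (@wide d K)) /= mulrDr.
set S : R := (size (sphere_seq d n))%:R; set b := _ * _; set a := _ * \sum_(y <- _ | ~~ _) _.
have S0 : 0 <= S by [].
have c0 := signed_perm_count_gt0.
have hb : b ^+ 2 <= wide_majorant n phi.
  rewrite /wide_majorant /wide_fraction -/S /b exprMn.
  have := sq_sum_seq (sphere_seq d n) (@wide d K) phi => /(ler_wpM2l (sqr_ge0 S^-1)).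
  move=> /le_trans; apply; rewrite expr2.
  by rewrite le_eqVlt; apply/orP; left; apply/eqP; ring.
have ha : a ^+ 2 <= stamp_majorant phi.
  have a0 : 0 <= a by rewrite mulr_ge0 ?invr_ge0 ?sumr_ge0.
  pose m := signed_perm_count^-1 * \sum_s \sum_p stamp_max phi s p.
  have am : a <= m.
    have [S00|Sn0] := eqVneq S 0.
      rewrite /a S00 invr0 mul0r; apply: mulr_ge0; first by rewrite invr_ge0 ltW.
      by apply: sumr_ge0 => s _; apply: sumr_ge0 => p _; apply: iter_max_ge0.
    have {}S0 : 0 < S by rewrite lt_neqAle eq_sym Sn0.
    rewrite /a /m ler_pdivrMl// mulrCA ler_pdivlMl//.
    exact: narrow_sum_le.
  apply: (@le_trans _ _ (m ^+ 2)).
    by rewrite ler_sqr ?nnegrE//; exact: le_trans am.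
  rewrite /m /stamp_majorant !pair_big /=.
  have := sq_sum_le xpredT (fun i : {set 'I_d} * {perm 'I_d} => stamp_max phi i.1 i.2).
  rewrite sumr_const card_prod natrM -/signed_perm_count.
  move=> /(ler_wpM2l (sqr_ge0 signed_perm_count^-1)); rewrite -exprMn => /le_trans; apply.
  by rewrite mulrA expr2 mulfVK ?gt_eqF.
have := sqr_ge0 (a - b); move: ha hb; move: (stamp_majorant phi) (wide_majorant n phi).
by clear; move=> x y; lra.
Qed.

End domination.

Import classical_sets.
Local Open Scope classical_set_scope.

(** * Sums over the lattice as integrals *)

Section counting_integral.
Variables (R : realType) (d : nat).
Implicit Types (phi psi : lattice d -> R).

(** The sum over the lattice, as the integral that defines the norms. *)
Definition lattice_sum phi : \bar R := (\int[counting]_x (phi x)%:E)%E.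

Lemma le_lattice_sum phi psi : (forall x, 0 <= phi x) -> (forall x, phi x <= psi x) ->
  (lattice_sum phi <= lattice_sum psi)%E.
Proof.
by move=> phi0 h; apply: ge0_le_integral => //= x _; rewrite lee_fin.
Qed.

Lemma lattice_sum_ge0 phi : (forall x, 0 <= phi x) -> (0 <= lattice_sum phi)%E.
Proof. by move=> h; apply: integral_ge0 => x _; rewrite lee_fin. Qed.

Lemma lattice_sumZ c phi : 0 <= c -> (forall x, 0 <= phi x) ->
  lattice_sum (fun x => c * phi x) = (c%:E * lattice_sum phi)%E.
Proof.
move=> c0 h; rewrite /lattice_sum.
under eq_integral do rewrite EFinM.
by apply: ge0_integralZl_EFin => // x _; rewrite lee_fin.
Qed.

Lemma lattice_sum_sum (I : Type) (r : seq I) (P : pred I) (phi : I -> lattice d -> R) :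
  (forall i x, 0 <= phi i x) ->
  lattice_sum (fun x => \sum_(i <- r | P i) phi i x) =
  (\sum_(i <- r | P i) lattice_sum (phi i))%E.
Proof.
move=> h; rewrite -big_filter -ge0_integral_sum//; last first.
  by move=> i x _; rewrite lee_fin.
by apply: eq_integral => x _; rewrite -sumEFin big_filter.
Qed.

Lemma lattice_sumD phi psi : (forall x, 0 <= phi x) -> (forall x, 0 <= psi x) ->
  lattice_sum (fun x => phi x + psi x) = (lattice_sum phi + lattice_sum psi)%E.
Proof.
move=> h1 h2; rewrite /lattice_sum -ge0_integralD//.
- by move=> x _; rewrite lee_fin.
- by move=> x _; rewrite lee_fin.
Qed.

(** Translations are bijections of the lattice. *)
Lemma counting_shift (a : lattice d) (A : classical_sets.set (lattice d)) :
  counting ((fun x => x + a) @^-1` A) = counting A :> \bar R.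
Proof.
have e : A = (fun x => x + a) @` ((fun x => x + a) @^-1` A).
  apply/seteqP; split=> [x Ax|_ [x Ax <-]//].
  by exists (x - a); rewrite /= subrK.
rewrite {2}e /counting.
have inj : injective (fun x : lattice d => x + a) by exact: addIr.
case: ifPn => /asboolP fA.
  rewrite asboolT; last exact: finite_image.
  by rewrite fset_set_image// (card_imfset _ _ inj).
rewrite asboolF//; apply: contra_not fA; rewrite -e.
by apply: finite_preimage => x y _ _; exact: inj.
Qed.

Lemma lattice_sum_shift phi a : (forall x, 0 <= phi x) ->
  lattice_sum (fun x => phi (x + a)) = lattice_sum phi.
Proof.
move=> h; have ms : measurable_fun [set: lattice d] (fun x : lattice d => x + a) by [].
have mf : measurable_fun setT (fun x : lattice d => (phi x)%:E) by [].
have := @ge0_integral_pushforward _ _ _ _ R _ ms counting setT (fun x => (phi x)%:E)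
  measurableT mf.
rewrite preimage_setT /lattice_sum => <-; last by move=> x _; rewrite lee_fin.
by apply: eq_measure_integral => A _ _; exact: counting_shift.
Qed.

End counting_integral.

(** * Transference from the cube to the lattice *)

Section majorant_integrals.
Variables (R : realType) (d K N : nat).
Hypotheses (K0 : (0 < K)%N) (dK : (32 * N.+1 <= d %/ K)%N).
Variable h : lattice d -> R.
Hypothesis h0 : forall x, 0 <= h x.

Let translate x : lattice d -> R := fun y => h (x - y).
Let hsq := lattice_sum (fun x => h x ^+ 2).

Let lattice_sum_translate y : lattice_sum (fun x => translate x y ^+ 2) = hsq.
Proof.
rewrite /translate (lattice_sum_shift (phi := fun x => h x ^+ 2)) // => x.
exact: sqr_ge0.
Qed.

Let hsq0 : (0 <= hsq)%E.
Proof. by apply: lattice_sum_ge0 => x; exact: sqr_ge0. Qed.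

Let cube_sum_const (T : finType) (v : \bar R) :
  (\sum_(i : T) v)%E = (#|T|%:R%:E * v)%E.
Proof. by rewrite sumr_const mule_natl. Qed.

Let max_at (x : lattice d) s p I : R :=
  iter_max N (blocks d K) (fun H => translate x (signed_perm s p (stamp K H))) I.

(** Moving on the cube by I amounts to moving x in the lattice and flipping the
    signs on I. *)
Let max_at_shift x s p I :
  max_at x s p I = max_at (x - signed_perm s p (stamp K I)) (symdiff s I) p finset.set0.
Proof.
rewrite /max_at -[in LHS](symdiff0 I) -(iter_max_shift _ _ _ I).
congr (iter_max _ _ _ _); apply/funext => H.
by rewrite signed_perm_stamp /translate opprD addrA.
Qed.

(** By max_at_shift and the invariance of the sum over the lattice, after
    reindexing the signs. *)
Let max_at_invariant p I :
  (\sum_(s : {set 'I_d}) lattice_sum (fun x => max_at x s p I ^+ 2)%R =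
   \sum_(s : {set 'I_d}) lattice_sum (fun x => max_at x s p finset.set0 ^+ 2)%R)%E.
Proof.
rewrite -(sum_symdiff I (fun s => lattice_sum (fun x => max_at x s p finset.set0 ^+ 2))).
apply: eq_bigr => s _.
rewrite -(lattice_sum_shift (phi := fun x => max_at x (symdiff s I) p finset.set0 ^+ 2)
  (- signed_perm s p (stamp K I))); last by move=> x; exact: sqr_ge0.
by congr lattice_sum; apply/funext => x; rewrite max_at_shift.
Qed.

Let set_count : R := #|{set 'I_d}|%:R.

Let set_count_gt0 : 0 < set_count.
Proof. by rewrite ltr0n; apply/card_gt0P; exists finset.set0. Qed.

(** By max_at_invariant the evaluation point set0 may be averaged over the whole
    cube, where iter_max_l2 applies for each x and each choice of signs.  The
    cube of stamps is then summed back over the lattice. *)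
Let max_at_l2 p :
  (\sum_(s : {set 'I_d}) lattice_sum (fun x => max_at x s p finset.set0 ^+ 2)%R <=
   (set_count * 328 ^+ K)%R%:E * hsq)%E.
Proof.
(* Multiplying by the size of the cube makes room for the average over I. *)
rewrite -(@lee_pmul2l _ set_count%:E) ?lte_fin//.
rewrite -cube_sum_const -(eq_bigr _ (fun I _ => max_at_invariant p I)).
rewrite exchange_big /=.
apply: (@le_trans _ _ (\sum_(s : {set 'I_d}) ((328 ^+ K) * set_count)%R%:E * hsq)%E); last first.
  by rewrite cube_sum_const EFinM [(set_count * _)%R]mulrC.
apply: lee_sum => s _; rewrite -lattice_sum_sum; last by move=> *; exact: sqr_ge0.
apply: (@le_trans _ _ (lattice_sum (fun x => 328 ^+ K *
    \sum_I translate x (signed_perm s p (stamp K I)) ^+ 2))).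
  apply: le_lattice_sum => x; first by apply: sumr_ge0 => I _; exact: sqr_ge0.
  have := iter_max_l2 (F := fun H => translate x (signed_perm s p (stamp K H))) (blocks_large dK).
  by rewrite size_map size_iota; apply => I; exact: h0.
rewrite lattice_sumZ ?exprn_ge0//; last by move=> x; apply: sumr_ge0 => I _; exact: sqr_ge0.
rewrite lattice_sum_sum; last by move=> *; exact: sqr_ge0.
rewrite (eq_bigr (fun=> hsq)) => [|I _]; last exact: lattice_sum_translate.
by rewrite cube_sum_const EFinM muleA.
Qed.

Lemma lattice_sum_stamp_majorant :
  (lattice_sum (fun x => stamp_majorant K N (fun y => h (x - y)))%R
    <= (328 ^+ K)%R%:E * lattice_sum (fun x => h x ^+ 2)%R)%E.
Proof.
have c0 := signed_perm_count_gt0 R d.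
have c0' : 0 <= (signed_perm_count R d)^-1 by rewrite invr_ge0 ltW.
rewrite /stamp_majorant lattice_sumZ//; last first.
  by move=> x; apply: sumr_ge0 => s _; apply: sumr_ge0 => p _; exact: sqr_ge0.
rewrite -(@lee_pmul2l R (signed_perm_count R d)%:E) ?lte_fin//.
rewrite muleA -EFinM divff ?gt_eqF// mul1e.
rewrite lattice_sum_sum; last by move=> s x; apply: sumr_ge0 => p _; exact: sqr_ge0.
under eq_bigr do rewrite (lattice_sum_sum _ _ (fun _ _ => sqr_ge0 _)).
rewrite exchange_big /=.
apply: (@le_trans _ _ (\sum_(p : {perm 'I_d}) (set_count * 328 ^+ K)%R%:E * hsq)%E).
  by apply: lee_sum => p _; exact: max_at_l2.
by rewrite cube_sum_const !muleA -!EFinM /signed_perm_count mulrA [(_%:R * set_count)%R]mulrC.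
Qed.

Lemma lattice_sum_wide_majorant n :
  lattice_sum (fun x => wide_majorant K n (fun y => h (x - y))) =
   ((wide_fraction R d K n ^+ 2)%R%:E * lattice_sum (fun x => h x ^+ 2)%R)%E.
Proof.
have w0 : 0 <= wide_fraction R d K n by rewrite /wide_fraction divr_ge0.
rewrite /wide_majorant lattice_sumZ//; last first.
  by move=> x; rewrite mulr_ge0 ?invr_ge0 ?sumr_ge0// => y _; exact: sqr_ge0.
rewrite lattice_sumZ ?invr_ge0//; last first.
  by move=> x; rewrite sumr_ge0// => y _; exact: sqr_ge0.
rewrite lattice_sum_sum; last by move=> *; exact: sqr_ge0.
rewrite (eq_bigr (fun=> hsq)) => [|y _]; last exact: lattice_sum_translate.
have -> : (\sum_(y <- sphere_seq d n | wide K y) hsq)%E =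
    ((count (wide K) (sphere_seq d n))%:R%:E * hsq)%E.
  by rewrite mule_natl big_const_seq iter_addr_0.
rewrite !muleA -!EFinM -mulrA.
by rewrite [(_^-1 * _)%R]mulrC expr2.
Qed.

(** H does not depend on n, so it controls the square of the maximal function; it
    is the sum of the narrow majorant and of all wide majorants. *)
Lemma l2_majorant :
  exists H : lattice d -> R,
    [/\ forall x, 0 <= H x,
     forall x n, (n <= N)%N -> sphere_mean n (fun y => h (x - y)) ^+ 2 <= H x &
     (lattice_sum H <= (2 * 328 ^+ K + 2 * \sum_(n < N.+1) wide_fraction R d K n ^+ 2)%R%:E
         * lattice_sum (fun x => (h x) ^+ 2)%R)%E].
Proof.
have W0 n (phi : lattice d -> R) : 0 <= wide_majorant K n phi :> R.
  by rewrite mulr_ge0 ?divr_ge0// mulr_ge0 ?invr_ge0 ?sumr_ge0// => y _; exact: sqr_ge0.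
have S0 (phi : lattice d -> R) : 0 <= stamp_majorant K N phi :> R.
  apply: mulr_ge0; first by rewrite invr_ge0 ltW// signed_perm_count_gt0.
  by apply: sumr_ge0 => s _; apply: sumr_ge0 => p _; exact: sqr_ge0.
have WS0 x : 0 <= \sum_(n < N.+1) wide_majorant K n (fun y => h (x - y)).
  by apply: sumr_ge0 => n _; exact: W0.
exists (fun x => 2 * stamp_majorant K N (fun y => h (x - y)) +
   2 * \sum_(n < N.+1) wide_majorant K n (fun y => h (x - y))); split.
- by move=> x; apply: addr_ge0; apply: mulr_ge0.
- move=> x n nN; apply: le_trans (sphere_mean_sq_le K0 dK _ nN) _; first by move=> y; exact: h0.
  rewrite lerD2l ler_pM2l//.
  rewrite (bigD1 (Ordinal (nN : (n < N.+1)%N)))//= lerDl; apply: sumr_ge0 => i _; exact: W0.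
- rewrite lattice_sumD; [|by move=> x; exact: mulr_ge0|by move=> x; exact: mulr_ge0].
  rewrite (lattice_sumZ (phi := fun x => stamp_majorant K N (fun y => h (x - y))))//.
  rewrite (lattice_sumZ (phi := fun x => \sum_(n < N.+1)
    wide_majorant K n (fun y => h (x - y))))//.
  have -> : (lattice_sum (fun x => \sum_(n < N.+1) wide_majorant K n (fun y => h (x - y)))%R
      = \sum_(n < N.+1) (wide_fraction R d K n ^+ 2)%R%:E * hsq)%E.
    by rewrite lattice_sum_sum//; apply: eq_bigr => n _; exact: lattice_sum_wide_majorant.
  rewrite -ge0_sume_distrl; last by move=> n _; rewrite lee_fin sqr_ge0.
  have w0 : 0 <= \sum_(n < N.+1) wide_fraction R d K n ^+ 2.
    by apply: sumr_ge0 => n _; exact: sqr_ge0.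
  rewrite sumEFin [X in (_ + X)%E]muleA -EFinM -/hsq.
  rewrite [X in (_ <= X)%E](_ : _ = (2 * 328 ^+ K)%:E * hsq +
    (2 * \sum_(n < N.+1) wide_fraction R d K n ^+ 2)%:E * hsq)%E; last first.
    by rewrite -ge0_muleDl ?lee_fin ?mulr_ge0 ?exprn_ge0.
  apply: leeD => //; rewrite EFinM -muleA lee_pmul2l ?lte_fin//.
  exact: lattice_sum_stamp_majorant.
Qed.

End majorant_integrals.

Import ComplexField.Normc.

(** * From squares to all exponents *)

Section averages.
Variables (R : realType) (d : nat).
Implicit Types (phi : lattice d -> R) (f : lattice d -> R[i]).

Lemma sphere_mean_ge0 n phi : (forall y, 0 <= phi y) -> 0 <= sphere_mean n phi.
Proof. by move=> h; rewrite mulr_ge0 ?invr_ge0 ?sumr_ge0. Qed.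

Lemma sphere_mean_le_const n phi (m : R) :
  0 <= m -> (forall y, phi y <= m) -> sphere_mean n phi <= m.
Proof.
move=> m0 h; rewrite /sphere_mean; have [S0|Sn0] := eqVneq ((size (sphere_seq d n))%:R : R) 0.
  by rewrite S0 invr0 mul0r.
rewrite ler_pdivrMl; last by rewrite lt_neqAle eq_sym Sn0 ler0n.
by rewrite -sum1_size natr_sum mulr_suml; apply: ler_sum => y _; rewrite mul1r.
Qed.

(** Jensen's inequality.  Young's inequality for phi(y) and a^(r-1), with a the
    mean of phi and conjugate exponents r and q, plays the part of the tangent
    line at a; averaging it over the sphere gives the claim. *)
Lemma sphere_mean_powR n phi (r : R) : 1 <= r -> (forall y, 0 <= phi y) ->
  sphere_mean n phi `^ r <= sphere_mean n (fun y => phi y `^ r).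
Proof.
move=> r1 phi0; have r0 : 0 < r by apply: lt_le_trans r1.
have R0 : 0 <= sphere_mean n (fun y => phi y `^ r).
  by apply: sphere_mean_ge0 => y; exact: powR_ge0.
have := sphere_mean_ge0 n phi0; rewrite le_eqVlt => /orP[/eqP <-|a0].
  by rewrite powR0 ?gt_eqF.
move: r1; rewrite le_eqVlt => /orP[/eqP r1|r1].
  have -> : sphere_mean n (fun y => phi y `^ r) = sphere_mean n phi.
    by congr (_ * _); apply: eq_bigr => y _; rewrite -r1 powRr1.
  by rewrite -r1 powRr1 // ltW.
set a := sphere_mean n phi in a0 *; pose q := r / (r - 1).
have rm : r - 1 != 0 by rewrite subr_eq0 gt_eqF.
have q0 : 0 < q by rewrite divr_gt0// subr_gt0.
have rq : r^-1 + q^-1 = 1.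
  by rewrite /q; field; rewrite rm gt_eqF.
have aq : (a `^ (r - 1)) `^ q = a `^ r.
  by rewrite -powRrM /q mulrCA divff// mulr1.
have ar : a * a `^ (r - 1) = a `^ r.
  by rewrite -[X in X * _]powRr1 ?ltW// -powRD ?gt_eqF ?implybT// addrC subrK.
have S0 : ((size (sphere_seq d n))%:R : R) != 0.
  by apply: contraTneq a0 => e; rewrite /a /sphere_mean e invr0 mul0r ltxx.
have : a * a `^ (r - 1) <= sphere_mean n (fun y => phi y `^ r) / r + a `^ r / q.
  apply: (@le_trans _ _ (sphere_mean n (fun y => phi y `^ r / r + a `^ r / q))).
    have Si : 0 < ((size (sphere_seq d n))%:R^-1 : R).
      by rewrite invr_gt0 lt_neqAle eq_sym S0 ler0n.
    rewrite {1}/a /sphere_mean -mulrA mulr_suml ler_pM2l//.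
    apply: ler_sum => y _; rewrite -aq.
    by apply: conjugate_powR => //; exact: powR_ge0.
  rewrite /sphere_mean big_split /= mulrDr -mulr_suml mulrA lerD2l.
  have -> : \sum_(y <- sphere_seq d n) a `^ r / q = (size (sphere_seq d n))%:R * (a `^ r / q).
    by rewrite big_const_seq iter_addr_0 count_predT mulr_natl.
  by rewrite mulKf.
rewrite ar; move: (sphere_mean n _) R0 => m m0; move: (a `^ r) => b.
have -> : q^-1 = 1 - r^-1 by rewrite -rq; ring.
rewrite mulrBr mulr1 => h; have : b / r <= m / r by lra.
by rewrite ler_pM2r// invr_gt0.
Qed.

Lemma normc_sum (r : seq (lattice d)) (F : lattice d -> R[i]) :
  normc (\sum_(y <- r) F y) <= \sum_(y <- r) normc (F y).
Proof.
elim: r => [|y r IH]; first by rewrite !big_nil normc0.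
rewrite !big_cons; apply: le_trans (le_normcD _ _) _.
by rewrite lerD2l.
Qed.

Lemma normc_natr n : normc (n%:R : R[i]) = n%:R.
Proof. by rewrite normcMn normc1. Qed.

Lemma normc_sphere_avg n f x :
  normc (sphere_avg n f x) <= sphere_mean n (fun y => normc (f (x - y))).
Proof.
rewrite /sphere_avg fsbig_finite; last exact: finite_sphere.
rewrite normcM normcV normc_natr /sphere_mean ler_wpM2l ?invr_ge0//.
exact: normc_sum.
Qed.

End averages.

Section lp_from_l2.
Variables (R : realType) (d N : nat) (C rad : R).
Hypotheses (C1 : 1 <= C) (rad0 : 0 <= rad).
Hypothesis radN : forall n : nat, n%:R <= rad -> (n <= N)%N.
Hypothesis l2 : forall h : lattice d -> R, (forall x, 0 <= h x) ->
  exists H : lattice d -> R,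
    [/\ forall x, 0 <= H x,
     forall x n, (n <= N)%N -> sphere_mean n (fun y => h (x - y)) ^+ 2 <= H x &
     (lattice_sum H <= C%:E * lattice_sum (fun x => (h x) ^+ 2)%R)%E].
Variable f : lattice d -> R[i].

Let g x := normc (f x).
Let g0 x : 0 <= g x. Proof. by rewrite /g; case: (f x) => a b; exact: sqrtr_ge0. Qed.

Let sphere_maximal_ge0 x : (0 <= sphere_maximal rad f x)%E.
Proof.
apply: (@le_trans _ _ (cabs (sphere_avg 0 f x))).
  by rewrite /cabs lee_fin; case: (sphere_avg _ _ _) => a b; exact: sqrtr_ge0.
by apply: ereal_sup_ubound; exists 0%N.
Qed.

Let sphere_maximal_le x (m : R) :
  (forall n, (n <= N)%N -> sphere_mean n (fun y => g (x - y)) <= m) ->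
  (sphere_maximal rad f x <= m%:E)%E.
Proof.
move=> h; apply: ge_ereal_sup => _ [n nr <-]; rewrite /cabs lee_fin.
by apply: le_trans (normc_sphere_avg _ _ _) _; apply: h; exact: radN.
Qed.

(** The hypothesis for squares is applied to h = |f|^(p/2); the constant becomes
    C^(1/p) <= C. *)
Let lp_fin (p : R) : 2 <= p ->
  (lp_norm p%:E (sphere_maximal rad f) <= C%:E * lp_norm p%:E (fun x => cabs (f x)))%E.
Proof.
move=> p2; have p0 : 0 < p by apply: lt_le_trans p2.
have pn0 : p != 0 by rewrite gt_eqF.
rewrite /lp_norm unlock /Lnorm.
pose h x := g x `^ (p / 2).
have hp x : h x ^+ 2 = g x `^ p.
  by rewrite /h -powR_mulrn ?powR_ge0// -powRrM divfK.
have [H [H0 Hmax HC]] := l2 (fun x => powR_ge0 (g x) (p / 2)).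
have e1 : (\int[counting]_x (`|cabs (f x)| `^ p) = lattice_sum (fun x => h x ^+ 2)%R)%E.
  apply: eq_integral => x _; rewrite hp /cabs abse_EFin poweR_EFin ger0_norm//.
  exact: g0.
have e2 : (\int[counting]_x (`|sphere_maximal rad f x| `^ p) <= lattice_sum H)%E.
  apply: ge0_le_integral => //= x _; first exact: poweR_ge0.
  rewrite gee0_abs//.
  apply: (@le_trans _ _ (((H x `^ p^-1)%:E) `^ p)%E); last first.
    by rewrite poweR_EFin -powRrM mulVf// powRr1.
  have mono := @gt0_ler_poweR R p (ltW p0).
  apply: mono; rewrite ?in_itv/= ?leey ?andbT ?sphere_maximal_ge0 ?lee_fin ?powR_ge0//.
  apply: sphere_maximal_le => n nN.
  have a0 : 0 <= sphere_mean n (fun y => g (x - y)) by apply: sphere_mean_ge0 => y.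
  have key : sphere_mean n (fun y => g (x - y)) `^ p <= H x.
    apply: le_trans (Hmax x n nN).
    rewrite -[X in _ `^ X](@divfK _ 2)// powRrM powR_mulrn ?powR_ge0//.
    rewrite ler_sqr ?nnegrE ?powR_ge0 ?sphere_mean_ge0//; last by move=> y; exact: powR_ge0.
    by apply: sphere_mean_powR => //; lra.
  have := @ge0_ler_powR R p^-1 _ _ _ _ _ key.
  rewrite -powRrM divff// powRr1//; apply; rewrite ?nnegrE ?powR_ge0 ?invr_ge0//.
  exact: ltW.
rewrite e1; apply: (@le_trans _ _ ((C%:E * lattice_sum (fun x => (h x) ^+ 2)%R) `^ p^-1)%E).
  have pi0 : 0 <= p^-1 by rewrite invr_ge0 ltW.
  apply: (@gt0_ler_poweR R p^-1 pi0); rewrite ?in_itv/= ?leey ?andbT.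
  - by apply: integral_ge0 => x _; exact: poweR_ge0.
  - by rewrite mule_ge0 ?lee_fin ?(le_trans _ C1)// lattice_sum_ge0// => x; exact: sqr_ge0.
  - exact: le_trans e2 HC.
have h2 : (0 <= lattice_sum (fun x => h x ^+ 2)%R)%E.
  by apply: lattice_sum_ge0 => x; exact: sqr_ge0.
rewrite poweRM// ?lee_fin ?(le_trans _ C1)//.
apply: lee_wpmul2r; first exact: poweR_ge0.
rewrite poweR_EFin lee_fin -[X in _ <= X]powRr1 ?(le_trans _ C1)//.
apply: ler_powR => //; rewrite invf_le1//; lra.
Qed.

(** The counting measure has no nonempty null set. *)
Let counting_ae (P : lattice d -> Prop) :
  (\forall x \ae (@counting (lattice d) R), P x) -> forall x, P x.
Proof.
move=> [A [_ A0 PA]] x; apply: contrapT => nPx.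
have Ax : A x by exact: PA.
move: A0; rewrite /counting; case: ifPn => // /asboolP fA [] /eqP.
rewrite pnatr_eq0 cardfs_eq0 => /eqP/(congr1 (fun B => x \in B)).
by rewrite in_fset_set// mem_set.
Qed.

Let lp_infty :
  (lp_norm +oo (sphere_maximal rad f) <= C%:E * lp_norm +oo (fun x => cabs (f x)))%E.
Proof.
rewrite /lp_norm unlock /Lnorm; case: ifPn => [T0|]; last by rewrite mule0.
set m := ess_sup _ (_ \o (fun x => cabs _)).
have fm x : (cabs (f x) <= m)%E.
  have := counting_ae (@ess_sup_ge _ _ _ counting (abse \o (fun x => cabs (f x)))) x.
  by apply: le_trans; rewrite /cabs /= lee_fin ler_norm.
have m0 : (0 <= m)%E by apply: le_trans (fm 0); rewrite lee_fin; exact: g0.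
apply: (@le_trans _ _ m); last first.
  by rewrite -[X in (X <= _)%E]mul1e; apply: lee_wpmul2r; rewrite ?lee_fin.
apply/ess_supP; apply: aeW => x /=; rewrite gee0_abs//.
case: m m0 fm => [m| |//] m0 fm; last exact: leey.
apply: sphere_maximal_le => n _; apply: sphere_mean_le_const; first by rewrite -lee_fin.
by move=> y; rewrite -lee_fin; exact: fm.
Qed.

Lemma lp_from_l2 (p : \bar R) : (2%:E <= p)%E ->
  (lp_norm p (sphere_maximal rad f) <= C%:E * lp_norm p (fun x => cabs (f x)))%E.
Proof.
by case: p => [p| |//]; [rewrite lee_fin; exact: lp_fin|move=> _; exact: lp_infty].
Qed.

End lp_from_l2.

(** The square of a mean is at most the mean of the squares, and each mean
    preserves the sum over the lattice. *)
Lemma l2_small (R : realType) (d N : nat) (h : lattice d -> R) : (forall x, 0 <= h x) ->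
  exists H : lattice d -> R,
    [/\ forall x, 0 <= H x,
     forall x n, (n <= N)%N -> sphere_mean n (fun y => h (x - y)) ^+ 2 <= H x &
     (lattice_sum H <= N.+1%:R%:E * lattice_sum (fun x => (h x) ^+ 2)%R)%E].
Proof.
move=> h0; have s0 n x : 0 <= sphere_mean n (fun y => h (x - y) ^+ 2).
  by apply: sphere_mean_ge0 => y; exact: sqr_ge0.
exists (fun x => \sum_(n < N.+1) sphere_mean n (fun y => h (x - y) ^+ 2)); split.
- by move=> x; apply: sumr_ge0 => n _; exact: s0.
- move=> x n nN; rewrite (bigD1 (Ordinal (nN : (n < N.+1)%N)))//=.
  apply: ler_wpDr; first by apply: sumr_ge0 => i _; exact: s0.
  rewrite /sphere_mean exprMn expr2 -mulrA ler_wpM2l ?invr_ge0//.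
  have [S0|Sn0] := eqVneq ((size (sphere_seq d n))%:R : R) 0.
    by rewrite S0 invr0 mul0r sumr_ge0// => y _; exact: sqr_ge0.
  rewrite ler_pdivrMl; last by rewrite lt_neqAle eq_sym Sn0 ler0n.
  have := sq_sum_seq (sphere_seq d n) xpredT (fun y => h (x - y)).
  by rewrite count_predT.
rewrite lattice_sum_sum; last by move=> n x; exact: s0.
have hsq0 : (0 <= lattice_sum (fun x => h x ^+ 2)%R)%E.
  by apply: lattice_sum_ge0 => x; exact: sqr_ge0.
have le1 n : (lattice_sum (fun x => sphere_mean n (fun y => h (x - y) ^+ 2))%R
    <= lattice_sum (fun x => h x ^+ 2)%R)%E.
  rewrite /sphere_mean lattice_sumZ ?invr_ge0//; last first.
    by move=> x; apply: sumr_ge0 => y _; exact: sqr_ge0.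
  rewrite lattice_sum_sum; last by move=> *; exact: sqr_ge0.
  rewrite (eq_bigr (fun=> lattice_sum (fun x => h x ^+ 2)%R)) => [|y _]; last first.
    by rewrite (lattice_sum_shift (phi := fun x => h x ^+ 2)) // => x; exact: sqr_ge0.
  have -> : (\sum_(y <- sphere_seq d n) lattice_sum (fun x => (h x) ^+ 2)%R =
      (size (sphere_seq d n))%:R%:E * lattice_sum (fun x => (h x) ^+ 2)%R)%E.
    by rewrite mule_natl big_const_seq iter_addr_0 count_predT.
  rewrite muleA -EFinM -[X in (_ <= X)%E]mul1e; apply: lee_wpmul2r => //.
  rewrite lee_fin; have [->|Sn0] := eqVneq ((size (sphere_seq d n))%:R : R) 0.
    by rewrite mulr0.
  by rewrite mulVf.
apply: (@le_trans _ _ (\sum_(n < N.+1) lattice_sum (fun x => (h x) ^+ 2)%R)%E).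
  by apply: lee_sum.
by rewrite sumr_const card_ord mule_natl.
Qed.

(** * The maximal theorem *)

Lemma wide_fraction_le (R : realFieldType) (d K N n : nat) (rho : R) :
  0 <= rho -> rho <= 1 -> (0 < d)%N -> (2 * N <= d)%N -> N%:R <= rho * d%:R ->
  (n <= N)%N ->
  wide_fraction R d K n <= (d * n.+1 * 2)%:R * rho ^+ (K.+1 ^ 2).
Proof.
move=> rho0 rho1 d0 Nd Nrho nN; rewrite /wide_fraction.
have [->|Sn0] := eqVneq ((size (sphere_seq d n))%:R : R) 0.
  by rewrite invr0 mulr0 mulr_ge0 ?exprn_ge0.
rewrite ler_pdivrMr; last by rewrite lt_neqAle eq_sym Sn0 ler0n.
exact: (count_wide rho0 rho1 d0 Nd Nrho).
Qed.

(** Each fraction is at most 2 d^2 / d^4, and there are at most d of them. *)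
Lemma sum_wide_fraction_le (R : realFieldType) (d K N : nat) (rho : R) :
  0 <= rho -> rho <= 1 -> (0 < d)%N -> (2 * N <= d)%N -> N%:R <= rho * d%:R ->
  rho ^+ (K.+1 ^ 2) <= (d%:R ^+ 4)^-1 ->
  \sum_(n < N.+1) wide_fraction R d K n ^+ 2 <= 4.
Proof.
move=> rho0 rho1 d0 Nd Nrho rhoK.
have dR : 1 <= (d%:R : R) by rewrite ler1n.
have dR0 : 0 < (d%:R : R) by lra.
have w (n : 'I_N.+1) : wide_fraction R d K n ^+ 2 <= 4 / d%:R.
  have w0 : 0 <= wide_fraction R d K n by rewrite divr_ge0.
  have w1 : wide_fraction R d K n <= 2 / d%:R.
    apply: le_trans (wide_fraction_le K rho0 rho1 d0 Nd Nrho (ltn_ord n)) _.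
    apply: (@le_trans _ _ (d%:R * d%:R * 2 / d%:R ^+ 4)).
      apply: ler_pM => //; first by rewrite exprn_ge0.
      by rewrite -!natrM ler_nat; have := ltn_ord n; nia.
    have -> : d%:R * d%:R * 2 / d%:R ^+ 4 = 2 / d%:R * d%:R^-1 :> R.
      by field; rewrite gt_eqF.
    by rewrite ler_piMr ?divr_ge0// invf_le1.
  apply: (@le_trans _ _ ((2 / d%:R) ^+ 2)).
    by rewrite ler_sqr ?nnegrE// divr_ge0.
  have -> : (2 / d%:R) ^+ 2 = 4 / d%:R * d%:R^-1 :> R by field; rewrite gt_eqF.
  by rewrite ler_piMr ?divr_ge0// invf_le1.
apply: (@le_trans _ _ (\sum_(n < N.+1) 4 / d%:R)); first by apply: ler_sum => n _; exact: w.
rewrite sumr_const card_ord -[_ *+ _]mulr_natl mulrA ler_pdivrMr// mulrC ler_pM2l//.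
by rewrite ler_nat; lia.
Qed.

Theorem theorem1p2 (R : realType) (eps : R) :
  0 < eps ->
  exists C : R, 0 < C /\
    forall (d : nat) (p : \bar R) (f : lattice d -> R[i]),
      (4 <= d)%N ->
      (2%:E <= p)%E ->
      (lp_norm p (fun x => cabs (f x)) < +oo)%E ->
      (lp_norm p (sphere_maximal (d%:R `^ (1 - eps)) f)
         <= C%:E * lp_norm p (fun x => cabs (f x)))%E.
Proof.
move=> eps0.
(* eps K >= 4 makes d^(- eps K) at most d^-4, which beats the three factors d
   lost in counting the wide points of all spheres. *)
pose K := (Num.trunc (4 / eps)).+1.
have Keps : 4 <= eps * K%:R.
  have := truncn_itv (ltW (divr_gt0 (ltr0n R 4) eps0)) => /andP[_ /ltW].
  by rewrite ler_pdivrMr// mulrC.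
(* For d >= D0 each of the K blocks has at least 32 (N + 1) coordinates:
   d^(- eps) <= 1 / c makes 32 K N at most d / 2. *)
pose c : R := 64 * K%:R.
have c1 : 1 <= c by rewrite /c -natrM ler1n.
pose D0 := ((Num.trunc (c `^ eps^-1)).+1 + 64 * K)%N.
pose C : R := D0%:R + 1 + (2 * 328 ^+ K + 2 * 4).
have C8 : 0 <= 2 * 328 ^+ K :> R by rewrite mulr_ge0 ?exprn_ge0.
have C1 : 1 <= C by rewrite /C; have := ler0n R D0; lra.
exists C; split; first by apply: lt_le_trans C1.
move=> d p f d4 p2 _.
have d1 : 1 <= (d%:R : R) by rewrite ler1n; apply: leq_trans d4.
have dR0 : 0 < (d%:R : R) by lra.
have hsq0 (h : lattice d -> R) : (0 <= lattice_sum (fun x => h x ^+ 2)%R)%E.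
  by apply: lattice_sum_ge0 => x; exact: sqr_ge0.
have [dD|Dd] := ltnP d D0.
  apply: (@lp_from_l2 R d d C (d%:R `^ (1 - eps)) C1 (powR_ge0 _ _)) => //.
    move=> n /le_trans h; rewrite -(ler_nat R); apply: h.
    by rewrite -[X in _ <= X]powRr1// ler_powR//; lra.
  move=> h h0; have [H [H0 Hm HC]] := l2_small d h0; exists H; split => //.
  apply: le_trans HC _; apply: lee_wpmul2r => //; rewrite lee_fin /C -natr1.
  have dD0 : (d%:R : R) <= D0%:R by rewrite ler_nat ltnW.
  by lra.
pose rho : R := d%:R `^ (- eps).
have rho0 : 0 <= rho by exact: powR_ge0.
have rhoc : rho * c <= 1.
  rewrite /rho powRN mulrC ler_pdivrMr ?powR_gt0// mul1r.
  have -> : c = (c `^ eps^-1) `^ eps.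
    by rewrite -powRrM mulVf ?gt_eqF// powRr1// (le_trans _ c1).
  apply: ge0_ler_powR; rewrite ?nnegrE ?powR_ge0 ?(ltW eps0) ?(ltW dR0)//.
  have := truncn_itv (powR_ge0 c eps^-1) => /andP[_ /ltW /le_trans]; apply.
  by rewrite ler_nat; apply: leq_trans Dd; rewrite leq_addr.
have rho1 : rho <= 1.
  have : rho * 1 <= rho * c by rewrite ler_wpM2l.
  by lra.
have rad : d%:R `^ (1 - eps) = rho * d%:R.
  rewrite /rho addrC powRD; last by apply/implyP => _; rewrite gt_eqF.
  by rewrite powRr1// ltW.
pose N := Num.trunc (rho * d%:R).
have rd0 : 0 <= rho * d%:R by rewrite mulr_ge0// ltW.
have Nle : N%:R <= rho * d%:R by rewrite /N truncn_le.
have cd : rho * c * d%:R <= d%:R by rewrite ler_piMl// ltW.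
have K1 : 1 <= (K%:R : R) by rewrite ler1n.
have dK : (32 * N.+1 <= d %/ K)%N.
  rewrite leq_divRL// -(ler_nat R) !natrM -natr1.
  have h1 : (N%:R : R) * K%:R <= rho * d%:R * K%:R by rewrite ler_wpM2r.
  have h2 : (64 * K)%:R <= (d%:R : R).
    by rewrite ler_nat; apply: leq_trans Dd; rewrite leq_addl.
  by move: h2 cd; rewrite natrM /c; lra.
have Nd : (2 * N <= d)%N.
  rewrite -(ler_nat R) natrM.
  have : rho * d%:R * 1 <= rho * d%:R * K%:R by rewrite ler_wpM2l.
  by move: cd; rewrite /c; lra.
have rhoK : rho ^+ (K.+1 ^ 2) <= (d%:R ^+ 4)^-1.
  apply: (@le_trans _ _ (rho ^+ K)).
    rewrite ler_wiXn2l//; apply: (@leq_trans K.+1) => //.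
    by rewrite -{1}(expn1 K.+1) leq_exp2l.
  rewrite /rho -powR_mulrn ?powR_ge0// -powRrM -powR_mulrn ?(ltW dR0)// -powRN.
  by rewrite ler_powR//; lra.
rewrite rad; apply: (@lp_from_l2 R d N C (rho * d%:R) C1 rd0) => //.
  by move=> n nr; rewrite /N truncn_ge_nat.
move=> h h0; have [H [H0 Hm HC]] := l2_majorant (ltn0Sn _ : (0 < K)%N) dK h0.
exists H; split => //; apply: le_trans HC _; apply: lee_wpmul2r => //.
rewrite lee_fin /C; have d0 : (0 < d)%N by apply: leq_trans d4.
have := sum_wide_fraction_le rho0 rho1 d0 Nd Nle rhoK.
by have := ler0n R D0; lra.
Qed.
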